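(* Let $I\ge0$, $\beta>0$, $\omega\in S_I$, and suppose $(1,\omega,\beta)$ (initial condition $\alpha=(1,0,\dots,0)$, all urns empty) is a feasible constraint, with associated twist parameters $\rho>0$, $C\ge0$. Then the infimum of $J(\gamma)$ over $A(1,\omega,\beta)$ is achieved by the occupancy path $\gamma\in A(1,\omega,\beta)$ defined by $$\gamma_0(x)=Ce^{-\rho x}+\sum_{k=0}^I\big(\omega_k-C\mathcal{P}_k(\rho\beta)\big)\Big(1-\frac{x}{\beta}\Big)^k,$$ $$\gamma_i(x)=\frac{x^i}{i!}(-1)^i\gamma_0^{(i)}(x),\quad 1\le i\le I,\qquad \gamma_{I+}(x)=1-\sum_{i=0}^I\gamma_i(x).$$ In addition, $\gamma$ satisfies the Euler–Lagrange equations.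
   Context: $S_I=\{\gamma\in\mathbb{R}^{I+2}:\gamma_j\ge0,\sum_{j=0}^{I+1}\gamma_j=1\}$, components indexed $0,\dots,I,I+$. Valid occupancy functions on $[0,\beta]$: absolutely continuous $\gamma:[0,\beta]\to S_I$ whose rates $\theta$ ($\dot\gamma_0=-\theta_0$, $\dot\gamma_j=\theta_{j-1}-\theta_j$, $1\le j\le I$, $\dot\gamma_{I+}=\theta_I$, $\sum\theta_j=1$) lie in $S_I$ a.e.; cumulative occupancies $\psi_i=\sum_{j\le i}\gamma_j$ ($\psi_{-1}\equiv0$), so $\dot\psi_i=-\theta_i$. $J(\gamma)=\int_0^\beta D(\theta\|\gamma)dx$ (relative entropy) for valid $\gamma$, $\infty$ otherwise. $A(\alpha,\omega,\beta)$: valid $\gamma$ with $\gamma(0)=\alpha,\gamma(\beta)=\omega$; feasible means nonempty; for empty initial condition this holds iff $\sum_{i=0}^I i\omega_i+(I+1)\omega_{I+}\le\beta$. $\mathcal{P}_i(t)=e^{-t}t^i/i!$. Twist parameters: if $\sum_{i=0}^I i\omega_i+(I+1)\omega_{I+}=\beta$, then (replacing $I$ by $I+1$ if necessary, regarding $\omega_{I+}$ as the fraction with exactly $I+1$ balls, so that $\omega_{I+}=0$) $C=0$ and $\rho=1$. Otherwise $\rho$ is the unique positive root of $\frac{\rho\beta-\sum_{i=0}^I i\mathcal{P}_i(\rho\beta)}{1-\sum_{i=0}^I\mathcal{P}_i(\rho\beta)}=\frac{\beta-\sum_{i=0}^I i\omega_i}{1-\sum_{i=0}^I\omega_i}$ and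 $C=\frac{1-\sum_{i=0}^I\omega_i}{1-\sum_{i=0}^I\mathcal{P}_i(\rho\beta)}$. Euler–Lagrange equations: with $\theta_{I+}=1-\sum_{i\le I}\theta_i$ and local cost $L(\psi,\theta)=\sum_{i=0}^I\theta_i\log\frac{\theta_i}{\psi_i-\psi_{i-1}}+\theta_{I+}\log\frac{\theta_{I+}}{1-\psi_I}$, they are $\frac{\partial L}{\partial\psi_i}(\psi(x),\theta(x))=-\frac{d}{dx}\frac{\partial L}{\partial\theta_i}(\psi(x),\theta(x))$ for $i=0,\dots,I$, $x\in(0,\beta)$, i.e. $-\frac{\theta_i}{\gamma_i}+\frac{\theta_{i+1}}{\gamma_{i+1}}=\frac{d}{dx}\{-\log\frac{\theta_i}{\gamma_i}+\log\frac{\theta_{I+}}{1-\psi_I}\}$ for $0\le i\le I-1$ and $-\frac{\theta_I}{\gamma_I}+\frac{\theta_{I+}}{1-\psi_I}=\frac{d}{dx}\{-\log\frac{\theta_I}{\gamma_I}+\log\frac{\theta_{I+}}{1-\psi_I}\}$. In the case $C=0$ (where $\psi_I\equiv1$, $\theta_I=\theta_{I+}=0$) they are the reduced equations $-\frac{\theta_i}{\psi_i-\psi_{i-1}}+\frac{\theta_{i+1}}{\psi_{i+1}-\psi_i}=\frac{d}{dx}\{-\log\frac{\theta_i}{\psi_i-\psi_{i-1}}\}$, $0\le i\le I-1$. *)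

(* Defs.v *)
From HB Require Import structures.
From mathcomp Require Import all_boot all_order all_algebra.
From mathcomp Require Import all_classical all_reals.
From mathcomp Require Import topology normedtype sequences derive exp
  measure lebesgue_measure lebesgue_integral.

Set Implicit Arguments.
Unset Strict Implicit.
Unset Printing Implicit Defensive.

Import Order.TTheory GRing.Theory Num.Theory.
Import numFieldNormedType.Exports.

Local Open Scope classical_set_scope.
Local Open Scope ring_scope.

Section Occupancy.
Variable R : realType.

(* Components of vectors in S_I are indexed by 'I_I.+2 :
   indices 0..I are the usual components, index I.+1 (= ord_max) is "I+". *)
Definition Iplus (I : nat) : 'I_I.+2 := ord_max.

Definition simplex (I : nat) (v : 'I_I.+2 -> R) : Prop :=
  (forall j, 0 <= v j) /\ \sum_(j < I.+2) v j = 1.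

Definition empty_init (I : nat) : 'I_I.+2 -> R :=
  fun j => if j == ord0 then 1 else 0.

Definition abs_cont_on (a b : R) (f : R -> R) : Prop :=
  forall e : R, 0 < e -> exists2 d : R, 0 < d &
    forall (n : nat) (u v : nat -> R),
      (forall k, (k < n)%N -> a <= u k /\ u k <= v k /\ v k <= b) ->
      (forall k, (k.+1 < n)%N -> v k <= u k.+1) ->
      \sum_(k < n) (v k - u k) < d ->
      \sum_(k < n) `|f (v k) - f (u k)| < e.

(* Cumulative occupancies psi_i = sum_{j <= i} gamma_j (i a natural number;
   psi_(I+1) is the total mass), and psi_(i-1) = sum_{j < i} gamma_j
   (so that psi_(-1) = 0). *)
Definition psi (I : nat) (g : 'I_I.+2 -> R -> R) (i : nat) (x : R) : R :=
  \sum_(j < I.+2 | (j <= i)%N) g j x.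
Definition psi_prev (I : nat) (g : 'I_I.+2 -> R -> R) (i : nat) (x : R) : R :=
  \sum_(j < I.+2 | (j < i)%N) g j x.

(* Rates: theta_i = - psi_i' for 0 <= i <= I (equivalently
   gamma_0' = -theta_0, gamma_j' = theta_(j-1) - theta_j), and
   theta_(I+) = 1 - sum_(i <= I) theta_i. *)
Definition theta (I : nat) (g : 'I_I.+2 -> R -> R) (j : 'I_I.+2) (x : R) : R :=
  if (j <= I)%N then - derive1 (psi g j) x
  else 1 - \sum_(i < I.+2 | (i <= I)%N) (- derive1 (psi g i) x).

Definition valid (I : nat) (beta : R) (g : 'I_I.+2 -> R -> R) : Prop :=
  (forall j, abs_cont_on 0 beta (g j)) /\
  (forall x, 0 <= x <= beta -> simplex (fun j => g j x)) /\
  {ae (@lebesgue_measure R), forall x, 0 <= x <= beta ->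
      simplex (fun j => theta g j x)}.

(* Term theta_j log (theta_j / gamma_j) of the relative entropy, with the
   conventions 0 log(0/g) = 0 and t log(t/0) = +oo for t > 0. *)
Definition ent_term (t g : R) : \bar R :=
  if t <= 0 then 0%E else if g <= 0 then +oo%E else (t * ln (t / g))%:E.

Definition rel_ent (I : nat) (t g : 'I_I.+2 -> R) : \bar R :=
  (\sum_(j < I.+2) ent_term (t j) (g j))%E.

Definition J (I : nat) (beta : R) (g : 'I_I.+2 -> R -> R) : \bar R :=
  if `[< valid beta g >] then
    (\int[@lebesgue_measure R]_(x in `[0%R, beta]%classic)
        rel_ent (fun j => theta g j x) (fun j => g j x))%E
  else +oo%E.

Definition A_set (I : nat) (alpha omega : 'I_I.+2 -> R) (beta : R)
    (g : 'I_I.+2 -> R -> R) : Prop :=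
  valid beta g /\ (forall j, g j 0 = alpha j) /\ (forall j, g j beta = omega j).

Definition feasible (I : nat) (alpha omega : 'I_I.+2 -> R) (beta : R) : Prop :=
  exists g, A_set alpha omega beta g.

Definition poisP (i : nat) (t : R) : R := expR (- t) * t ^+ i / (i`!)%:R.

Definition mean_balls (I : nat) (omega : 'I_I.+2 -> R) : R :=
  \sum_(0 <= i < I.+1) i%:R * omega (inord i) + (I.+1)%:R * omega (Iplus I).

Definition twist (I : nat) (beta : R) (omega : 'I_I.+2 -> R) (rho C : R) : Prop :=
  (mean_balls omega = beta /\ C = 0 /\ rho = 1) \/
  (mean_balls omega != beta /\ 0 < rho /\
   (rho * beta - \sum_(0 <= i < I.+1) i%:R * poisP i (rho * beta))
     / (1 - \sum_(0 <= i < I.+1) poisP i (rho * beta))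
   = (beta - \sum_(0 <= i < I.+1) i%:R * omega (inord i))
     / (1 - \sum_(0 <= i < I.+1) omega (inord i)) /\
   C = (1 - \sum_(0 <= i < I.+1) omega (inord i))
       / (1 - \sum_(0 <= i < I.+1) poisP i (rho * beta))).

(* gamma_0 of the optimal path.  In the boundary case
   mean_balls omega = beta the paper replaces I by I+1 (omega_{I+} being
   regarded as the fraction of urns with exactly I+1 balls); this adds the
   term omega_{I+} (1 - x/beta)^(I+1) (C = 0 in that case). *)
Definition opt_gamma0 (I : nat) (beta : R) (omega : 'I_I.+2 -> R) (rho C : R)
    (x : R) : R :=
  C * expR (- (rho * x))
  + \sum_(0 <= k < I.+1)
       (omega (inord k) - C * poisP k (rho * beta)) * (1 - x / beta) ^+ k
  + (if mean_balls omega == beta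
     then omega (Iplus I) * (1 - x / beta) ^+ I.+1 else 0).

Definition opt_gamma_nat (I : nat) (beta : R) (omega : 'I_I.+2 -> R) (rho C : R)
    (i : nat) (x : R) : R :=
  x ^+ i / (i`!)%:R * (-1) ^+ i * derive1n i (opt_gamma0 beta omega rho C) x.

Definition opt_path (I : nat) (beta : R) (omega : 'I_I.+2 -> R) (rho C : R)
    (j : 'I_I.+2) (x : R) : R :=
  if (j <= I)%N then opt_gamma_nat beta omega rho C j x
  else 1 - \sum_(0 <= i < I.+1) opt_gamma_nat beta omega rho C i x.

Definition EL_general (I : nat) (beta : R) (g : 'I_I.+2 -> R -> R) : Prop :=
  forall x, 0 < x < beta ->
  (forall i : nat, (i < I)%N ->
     is_derive x 1
       (fun y => - ln (theta g (inord i) y / g (inord i) y)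
                 + ln (theta g (Iplus I) y / (1 - psi g I y)))
       (- (theta g (inord i) x / g (inord i) x)
        + theta g (inord i.+1) x / g (inord i.+1) x)) /\
  is_derive x 1
    (fun y => - ln (theta g (inord I) y / g (inord I) y)
              + ln (theta g (Iplus I) y / (1 - psi g I y)))
    (- (theta g (inord I) x / g (inord I) x)
     + theta g (Iplus I) x / (1 - psi g I x)).

(* Reduced Euler-Lagrange equations (case C = 0), for 0 <= i < m, where
   m is the (possibly replaced) value of I. *)
Definition EL_reduced (I : nat) (beta : R) (g : 'I_I.+2 -> R -> R) (m : nat) : Prop :=
  forall x, 0 < x < beta ->
  forall i : nat, (i < m)%N ->
     is_derive x 1
       (fun y => - ln (theta g (inord i) y / (psi g i y - psi_prev g i y)))
       (- (theta g (inord i) x / (psi g i x - psi_prev g i x))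
        + theta g (inord i.+1) x / (psi g i.+1 x - psi g i x)).

Definition EL (I : nat) (beta : R) (omega : 'I_I.+2 -> R) (C : R)
    (g : 'I_I.+2 -> R -> R) : Prop :=
  if C == 0 then EL_reduced beta g (if 0 < omega (Iplus I) then I.+1 else I)
  else EL_general beta g.

End Occupancy.

(* Main.v *)
Require Import Defs.
From HB Require Import structures.
From mathcomp Require Import all_boot all_order all_algebra.
From mathcomp Require Import all_classical all_reals.
From mathcomp Require Import topology normedtype sequences derive exp
  measure lebesgue_measure lebesgue_integral.
From mathcomp Require Import all_analysis measurable_realfun.
From mathcomp Require Import zify ring lra.

Set Implicit Arguments.
Unset Strict Implicit.
Unset Printing Implicit Defensive.

Import Order.TTheory GRing.Theory Num.Theory.
Import numFieldNormedType.Exports.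

Local Open Scope classical_set_scope.
Local Open Scope ring_scope.

(** Put [F_j = (-1)^j gamma_0^(j)].  Then [F_j' = - F_(j+1)], the optimal path is
    [gamma_j = x^j/j! F_j] with rates [theta_j = x^j/j! F_(j+1)], and
    [theta_(I+) = r gamma_(I+)] where [r = rho], or [r = 0] when the balls just
    suffice.  The entropy is convex: [t ln (t/g) >= t ln q + t - q g] for every
    [q > 0].  Taking [q_j = F_(j+1) / F_j], the lower bound for a competitor [g] is
    the derivative of [x + sum_j g_j ln F_j + ln r (x - sum_j j g_j)], so its
    integral depends only on the endpoints, and equality holds on the optimal path.
    Since some [F_j] may vanish at [beta] (or identically), the bound is applied to
    [F + eps H] with a positive system [H], and [eps] tends to [0].

    Integrating the lower bound requires the fundamental theorem of calculus for
    absolutely continuous functions.  Such an [f] is the difference of the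
    nondecreasing absolutely continuous functions [TV + f] and [TV], with [TV] the
    total variation; the Lebesgue-Stieltjes measure of a nondecreasing absolutely
    continuous function is dominated by the Lebesgue measure, hence has a
    Radon-Nikodym density, which is its derivative at almost every point. *)

(** * Absolutely continuous functions *)

Section abs_cont_variation.
Context {R : realType}.
Implicit Types (a b : R) (f : R -> R).

Notation TV := total_variation.
Notation before := (fun p q : R * R => p.2 <= q.1).

(** Lists of pairs can be concatenated, so this form of absolute continuity lets the partitions of
    several intervals be merged into one family. *)
Lemma abs_cont_on_seq a b f : abs_cont_on a b f ->
  forall e, 0 < e -> exists2 d, 0 < d & forall s : seq (R * R),
    all (fun p => [&& a <= p.1, p.1 <= p.2 & p.2 <= b]) s -> pairwise before s ->
    \sum_(p <- s) (p.2 - p.1) < d -> \sum_(p <- s) `|f p.2 - f p.1| < e.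
Proof.
move=> fac e e0; have [d d0 H] := fac e e0; exists d => // s /allP sab sbef.
rewrite !(big_nth (0, 0)) !big_mkord => sd.
apply: (H (size s) (fun k => (nth (0, 0) s k).1) (fun k => (nth (0, 0) s k).2)) => //.
- by move=> k ks; have /and3P[] := sab _ (mem_nth (0, 0) ks).
- move=> k ks; move/(pairwiseP (0, 0)) : sbef; apply => //.
  by rewrite inE (ltn_trans _ ks).
Qed.

Lemma itv_partition_pairs u v s : itv_partition u v s ->
  [/\ all (fun p => [&& u <= p.1, p.1 <= p.2 & p.2 <= v]) (zip (u :: s) s),
      pairwise before (zip (u :: s) s) &
      \sum_(p <- zip (u :: s) s) (p.2 - p.1) = v - u].
Proof.
elim: s u => [|x s IH] u [/= us /eqP lu].
  by split => //; rewrite big_nil -lu subrr.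
case/andP: us => ux xs.
have /IH[/allP Hall Hpw Hsum] : itv_partition x v s by split => //; exact/eqP.
have xv : x <= v.
  by apply: (@itv_partition_le _ _ x v s); split => //; exact/eqP.
split.
- rewrite /= lexx (ltW ux) xv/=; apply/allP => p /Hall /and3P[xp pp pv].
  by rewrite pp pv (le_trans (ltW ux) xp).
- rewrite /= Hpw andbT; apply/allP => p /Hall /and3P[xp _ _].
  exact: xp.
- by rewrite big_cons Hsum /= addrC subrKA.
Qed.

(** Subdividing the intervals does not change their total length, so the [d] of [abs_cont_on] still
    controls the sums over arbitrary partitions. In this form the estimate passes to suprema over
    partitions. *)
Lemma abs_cont_on_variation a b f : abs_cont_on a b f ->
  forall e, 0 < e -> exists2 d, 0 < d &
  forall (n : nat) (u v : nat -> R) (s : nat -> seq R),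
      (forall k, (k < n)%N -> a <= u k /\ u k <= v k /\ v k <= b) ->
      (forall k, (k.+1 < n)%N -> v k <= u k.+1) ->
      (forall k, (k < n)%N -> itv_partition (u k) (v k) (s k)) ->
      \sum_(k < n) (v k - u k) < d ->
      \sum_(k < n) variation (u k) (v k) f (s k) < e.
Proof.
move=> /abs_cont_on_seq fac e e0; have [d d0 H] := fac e e0; exists d => //.
move=> n u v s uv vu us.
pose P k := zip (u k :: s k) (s k).
pose L m := flatten [seq P k | k <- iota 0 m].
have LS m : L m.+1 = L m ++ P m.
  by rewrite /L -addn1 iotaD map_cat flatten_cat/= cats0.
(* Invariant of the concatenation of the first [m] partitions. The second conjunct, that all pairs
   so far end before the later intervals start, keeps the list ordered when [P m] is appended. *)
have HL m : (m <= n)%N ->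
  [/\ all (fun p => [&& a <= p.1, p.1 <= p.2 & p.2 <= b]) (L m),
      (forall k, (m <= k < n)%N -> all (fun p => p.2 <= u k) (L m)),
      pairwise before (L m),
      \sum_(p <- L m) (p.2 - p.1) = \sum_(k < m) (v k - u k) &
      \sum_(p <- L m) `|f p.2 - f p.1| = \sum_(k < m) variation (u k) (v k) f (s k)].
  elim: m => [|m IH mn]; first by rewrite /L/= !big_nil !big_ord0; split.
  have [IHall IHu IHpw IHlen IHvar] := IH (ltnW mn).
  have [/allP Pall Ppw Plen] := itv_partition_pairs (us m mn).
  have [aum [umvm vmb]] := uv m mn.
  rewrite LS; split.
  - rewrite all_cat IHall/=; apply/allP => p /Pall /and3P[up pp pv].
    by rewrite pp (le_trans aum up) (le_trans pv vmb).
  - move=> k /andP[mk kn]; rewrite all_cat IHu ?(ltnW mk)//=.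
    apply/allP => p /Pall /and3P[_ _ pv]; apply: (le_trans pv).
    have : forall j, (m < j)%N -> (j < n)%N -> v m <= u j.
      elim=> // j IHj; rewrite ltnS leq_eqVlt => /predU1P[<-|mj] jn.
        exact: vu.
      apply: (le_trans (IHj mj (ltnW jn))); have [_ [+ _]] := uv j (ltnW jn).
      by move=> /le_trans; apply; exact: vu.
    exact.
  - rewrite pairwise_cat IHpw Ppw !andbT; apply/allrelP => p q pL /Pall /and3P[uq _ _].
    have mnn : (m <= m < n)%N by rewrite leqnn.
    exact: (le_trans (allP (IHu m mnn) p pL)).
  - by rewrite big_cat/= IHlen Plen big_ord_recr.
  - rewrite big_cat/= IHvar big_ord_recr/=; congr (_ + _).
    rewrite (variation_zip _ (us _ mn)) /P.
    move: (_ :: _) => t; elim: (s m) t => [|x r IHr] [|y t]; rewrite ?big_nil//.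
    by rewrite !big_cons IHr.
have [Lall _ Lpw Llen Lvar] := HL n (leqnn n).
by move=> lend; rewrite -Lvar; apply: H => //; rewrite Llen.
Qed.

(** Cut [[a, b]] into [N.+1] equal pieces shorter than the [d] belonging to the tolerance 1: the
    variation is at most 1 on each piece. *)
Lemma abs_cont_on_bounded_variation a b f : a <= b ->
  abs_cont_on a b f -> bounded_variation a b f.
Proof.
move=> ab /abs_cont_on_variation /(_ 1 ltr01)[d d0 H].
have small u v : a <= u -> u <= v -> v <= b -> v - u < d -> (TV u v f <= 1%:E)%E.
  move=> au uv vb uvd; apply: ge_ereal_sup => _ [_ [s us <-] <-].
  rewrite lee_fin ltW//; have := H 1 (fun=> u) (fun=> v) (fun=> s).
  by rewrite !big_ord_recr !big_ord0/= !add0r; apply => // -[].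
have [N Nd] : exists N : nat, (b - a) / N.+1%:R < d.
  exists (Num.bound ((b - a) / d)).
  rewrite ltr_pdivrMr// mulrC -ltr_pdivrMr//.
  have bad0 : 0 <= (b - a) / d by rewrite divr_ge0 ?subr_ge0// ltW.
  apply: (lt_le_trans (archi_boundP bad0)).
  by rewrite ler_nat.
pose t k := a + k%:R * ((b - a) / N.+1%:R).
have ba : 0 <= (b - a) / N.+1%:R by rewrite divr_ge0// subr_ge0.
have tab k : (k <= N.+1)%N -> a <= t k <= b.
  move=> kN; rewrite /t lerDl mulr_ge0//= -lerBrDl mulrCA ler_piMr// ?subr_ge0//.
  by rewrite ler_pdivrMr// mul1r ler_nat.
have TVt k : (k <= N.+1)%N -> (TV a (t k) f <= k%:R%:E)%E.
  elim: k => [_|k IH kN]; first by rewrite /t mul0r addr0 total_variationxx.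
  have /andP[atk _] := tab _ (ltnW kN); have /andP[_ tkb] := tab _ kN.
  have ttS : t k.+1 - t k = (b - a) / N.+1%:R by rewrite /t -natr1; ring.
  have tle : t k <= t k.+1 by rewrite -subr_ge0 ttS.
  rewrite (total_variationD f atk tle) -natr1 EFinD leeD//; first exact/IH/ltnW.
  by apply: small => //; rewrite ttS.
apply/bounded_variationP => //.
have -> : b = t N.+1 by rewrite /t mulrC divfK// addrC subrK.
rewrite ge0_fin_numE; first exact: (le_lt_trans (TVt _ (leqnn _))) (ltry _).
by apply: total_variation_ge0; have /andP[] := tab _ (leqnn N.+1).
Qed.

(** On each interval a partition nearly attains the total variation. The partition sums stay below
    [e / 2] by [abs_cont_on_variation], and the errors add up to at most [e / 2]. *)
Lemma abs_cont_on_total_variation a b f : a <= b ->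
  abs_cont_on a b f -> abs_cont_on a b (fun x => fine (TV a x f)).
Proof.
move=> ab fac e e0; have BVf := abs_cont_on_bounded_variation ab fac.
have e2 : 0 < e / 2 by rewrite divr_gt0.
have [d d0 H] := abs_cont_on_variation fac e2; exists d => // n u v uv vu lend.
have TVfin x y : a <= x -> x <= y -> y <= b -> TV x y f \is a fin_num.
  move=> ax xy yb; apply/bounded_variationP => //.
  exact/(bounded_variationl xy yb)/(bounded_variationr ax (le_trans xy yb)).
(* The error allowed on each of the [n] intervals; dividing by [n.+1] covers [n = 0]. *)
have e' : 0 < e / 2 / n.+1%:R by rewrite divr_gt0.
have /choice[s sP] : forall k, exists s, (k < n)%N ->
    itv_partition (u k) (v k) s /\
    fine (TV (u k) (v k) f) - e / 2 / n.+1%:R < variation (u k) (v k) f s.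
  move=> k; case: (ltnP k n) => kn; last by exists [::].
  have [auk [uvk vbk]] := uv k kn.
  have fin := TVfin _ _ auk uvk vbk.
  have [_ [_ [s us <-] <-] h] := ub_ereal_sup_adherent e' fin.
  exists s => _; split => //; rewrite -lte_fin EFinB fineK//.
have {}H : \sum_(k < n) variation (u k) (v k) f (s k) < e / 2.
  by apply: H => // k kn; have [] := sP k kn.
apply: (@le_lt_trans _ _ (\sum_(k < n) (variation (u k) (v k) f (s k) + e / 2 / n.+1%:R))).
  apply: ler_sum => k _; have [auk [uvk vbk]] := uv k (ltn_ord k).
  rewrite (total_variationD f auk uvk) fineD; last 2 first.
    by apply: TVfin => //; exact: le_trans vbk.
    exact: TVfin.
  rewrite addrC addKr ger0_norm ?fine_ge0 ?total_variation_ge0//.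
  by rewrite -lerBlDr ltW//; have [] := sP k (ltn_ord k).
rewrite big_split/= sumr_const card_ord -[X in _ + X]mulr_natr [e in ltRHS](splitr e).
rewrite ltr_leD//.
by rewrite mulrAC ler_pdivrMr// ler_pM2l// ler_nat.
Qed.

End abs_cont_variation.

(** * Measure of open sets by grids *)

Section grid.
Context {R : realType}.
Variables (a b : R) (ab : a < b).

Let t n i : R := a + i%:R * ((b - a) / n.+1%:R).
Let cell n i : set R := `]t n i, t n i.+1]%classic.
Let mu : {measure set (measurableTypeR R) -> \bar R} := @lebesgue_measure R.

Let step_gt0 n : 0 < (b - a) / n.+1%:R.
Proof. by rewrite divr_gt0// subr_gt0. Qed.

Let t_homo n i j : (i <= j)%N -> t n i <= t n j.
Proof. by move=> ij; rewrite /t lerD2l ler_pM2r// ler_nat. Qed.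

Let t_step n i : t n i.+1 - t n i = (b - a) / n.+1%:R.
Proof. by rewrite /t -natr1; ring. Qed.

Let t_last n : t n n.+1 = b.
Proof. by rewrite /t mulrC divfK// addrC subrK. Qed.

Let cell_ex n x : a < x <= b -> exists2 i, (i < n.+1)%N & cell n i x.
Proof.
move=> /andP[ax xb].
have ex : exists k, x <= t n k by exists n.+1; rewrite t_last.
case: (ex_minnP ex) => -[|k]; first by rewrite /t mul0r addr0 leNgt ax.
move=> xk kmin; exists k; first by apply: kmin; rewrite t_last.
rewrite /cell/= in_itv/= xk andbT ltNge; apply/negP => /kmin.
by rewrite ltnn.
Qed.

(* [U `&` `]a, b]] is the increasing union over [m] of the sets of points whose
   grid cells of all mesh sizes at most [(b - a) / m.+1] are contained in [U]. *)
Lemma open_grid_measure (nu : {measure set (measurableTypeR R) -> \bar R})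
    (F : R -> R) (d e : R) (U : set R) :
  (forall x y, x <= y -> nu `]x, y]%classic = (F y - F x)%:E) ->
  (forall n (u v : nat -> R),
      (forall k, (k < n)%N -> a <= u k /\ u k <= v k /\ v k <= b) ->
      (forall k, (k.+1 < n)%N -> v k <= u k.+1) ->
      \sum_(k < n) (v k - u k) < d ->
      \sum_(k < n) `|F (v k) - F (u k)| < e) ->
  open U -> (mu U < d%:E)%E -> (nu (U `&` `]a, b]) <= e%:E)%E.
Proof.
move=> nuF HF oU Ud.
have mU : measurable (U : set (measurableTypeR R)) by exact: open_measurable.
pose V n i : set (measurableTypeR R) :=
  if `[< cell n i `<=` U >] then cell n i else set0.
have mV n i : measurable (V n i).
  by rewrite /V; case: ifP => _; [exact: measurable_itv|exact: measurable0].
have tV n : trivIset setT (V n).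
  have lem i j x : (i < j)%N -> V n i x -> V n j x -> False.
    rewrite /V; case: ifP => // _; case: ifP => // _ ij.
    rewrite /cell/= !in_itv/= => /andP[_ h1] /andP[h2 _].
    have := lt_le_trans h2 h1; rewrite ltNge => /negP; apply.
    exact: t_homo.
  move=> i j _ _ [x [xi xj]]; case: (ltngtP i j) => // ij.
    by case: (lem _ _ _ ij xi xj).
  by case: (lem _ _ _ ij xj xi).
pose S n : set (measurableTypeR R) := \big[setU/set0]_(i < n.+1) V n i.
have mS n : measurable (S n) by exact: bigsetU_measurable.
have SU n : S n `<=` U.
  rewrite /S -bigcup_mkord => x [i _]; rewrite /V; case: ifPn => // /asboolP.
  exact.
have nuS n : (nu (S n) <= e%:E)%E.
  pose u i := t n i.
  (* A cell that is not inside [U] becomes a degenerate interval at its left end, so the family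
     stays indexed by all cells, in order, with [V n i] of length [v i - u i]. *)
  pose v i := if `[< cell n i `<=` U >] then t n i.+1 else t n i.
  have uv i : u i <= v i by rewrite /u /v; case: ifP => // _; exact: t_homo.
  have muV i : mu (V n i) = (v i - u i)%:E.
    rewrite /V /v /u; case: ifP => _; last by rewrite measure0 subrr.
    rewrite /mu /= /cell lebesgue_measure_itv/= lte_fin -subr_gt0 t_step step_gt0.
    by rewrite -EFinB t_step.
  have nuV i : nu (V n i) = (F (v i) - F (u i))%:E.
    rewrite /V /v /u; case: ifP => _; last by rewrite measure0 subrr.
    by rewrite nuF//; exact: t_homo.
  rewrite /S (measure_bigsetU nu (mV n) (tV n)).
  rewrite (eq_bigr (fun i : 'I_n.+1 => (F (v i) - F (u i))%:E)); last first.
    by move=> i _; exact: nuV.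
  rewrite sumEFin lee_fin.
  apply: (@le_trans _ _ (\sum_(i < n.+1) `|F (v i) - F (u i)|)).
    by apply: ler_sum => i _; exact: ler_norm.
  apply/ltW/HF.
  - move=> k kn; split; last split => //.
      by rewrite /u -[leLHS](_ : t n 0 = _) ?t_homo// /t mul0r addr0.
    rewrite /v -(t_last n); case: ifP => _; first exact: t_homo.
    by apply: t_homo; exact: ltnW.
  - by move=> k _; rewrite /v /u; case: ifP => // _; exact: t_homo.
  - rewrite -lte_fin -sumEFin; apply: le_lt_trans Ud.
    rewrite (eq_bigr (fun i : 'I_n.+1 => mu (V n i))); last first.
      by move=> i _; exact/esym/muV.
    rewrite -(measure_bigsetU mu (mV n) (tV n)).
    by apply: le_measure; [rewrite inE; exact: mS|rewrite inE|exact: (SU n)].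
pose W m : set (measurableTypeR R) := \bigcap_i S (m + i)%N.
have mW m : measurable (W m) by apply: bigcapT_measurable => i; exact: mS.
have ndW : {homo W : n m / (n <= m)%N >-> (n <= m)%O}.
  move=> n m nm; apply/subsetPset => x Wx i _.
  by have := Wx (m - n + i)%N I; rewrite addnA subnKC.
have UW : U `&` `]a, b] `<=` \bigcup_m W m.
  move=> x [Ux]; rewrite /= in_itv/= => xab.
  have [r /= r0 rU] : \forall r \near (0:R)^'+, ball x r `<=` U.
    have [r /= r0 rU] := oU _ Ux.
    exists r => //= s; rewrite /ball/= sub0r normrN => sr s0 y xy.
    apply: rU; rewrite /ball/= in xy *; apply: (lt_trans xy).
    by rewrite (le_lt_trans (ler_norm _) sr).
  have {}rU : ball x (r / 2) `<=` U.
    apply: rU; last by rewrite /= divr_gt0.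
    rewrite /= sub0r normrN gtr0_norm ?divr_gt0// ltr_pdivrMr// ltr_pMr//.
    by rewrite ltr1n.
  have r20 : 0 < r / 2 by rewrite divr_gt0.
  have c0 : 0 <= (b - a) / (r / 2) by rewrite divr_ge0 ?subr_ge0// ltW.
  (* From this index on the mesh is below [r / 2], so the cell containing [x] lies in the ball
     around [x]. *)
  exists (Num.bound ((b - a) / (r / 2))) => // i _.
  rewrite /S -bigcup_mkord; set n := (_ + i)%N.
  have nr : (b - a) / n.+1%:R < r / 2.
    rewrite ltr_pdivrMr// mulrC -ltr_pdivrMr//.
    apply: (lt_le_trans (archi_boundP c0)); rewrite ler_nat /n.
    by rewrite -addnS leq_addr.
  have [k kn kx] := cell_ex n xab.
  exists k => //; rewrite /V asboolT// => y ky; apply: rU.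
  rewrite /ball/= ltr_norml; move: kx ky; rewrite /cell/= !in_itv/=.
  have := t_step n k; move: (t n k.+1) (t n k) ((b - a) / n.+1%:R) (r / 2) nr.
  by move=> p q s w; lra.
apply: (@le_trans _ _ (nu (\bigcup_m W m))).
  apply: le_measure => //; rewrite inE.
    by apply: measurableI => //; exact: measurable_itv.
  exact: bigcupT_measurable.
apply: (cvge_to_le (nondecreasing_cvg_mu mW _ ndW)).
  exact: bigcupT_measurable.
apply: nearW => m /=; apply: le_trans (nuS m).
apply: le_measure; rewrite ?inE//.
by move=> x /(_ 0%N I); rewrite addn0.
Qed.

End grid.

(** * Density of a nondecreasing absolutely continuous function *)

Section abs_cont_density.
Context {R : realType}.
Notation mu := (@lebesgue_measure R).
Implicit Types (a b : R) (f : R -> R).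

Lemma abs_cont_on_unif_cont a b f : abs_cont_on a b f ->
  forall e, 0 < e -> exists2 d, 0 < d &
  forall x y, a <= x <= b -> a <= y <= b -> `|x - y| < d -> `|f x - f y| < e.
Proof.
move=> fac e e0; have [d d0 H] := fac e e0; exists d => // x y.
wlog : x y / x <= y.
  move=> h; case: (leP x y) => [|/ltW] xy xab yab; first exact: h.
  by rewrite distrC (distrC (f x)); exact: h.
move=> xy /andP[ax xb] /andP[ay yb]; rewrite distrC ger0_norm ?subr_ge0// => xyd.
have := H 1 (fun=> x) (fun=> y); rewrite !big_ord_recr !big_ord0/= !add0r distrC.
by apply => // -[].
Qed.

(** A Lebesgue-null set has, by outer regularity, an open neighbourhood of measure below the [d] of
    absolute continuity, and [open_grid_measure] bounds the Stieltjes measure of that neighbourhood.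
    This gives the domination that Radon-Nikodym needs. *)
Lemma nondecreasing_abs_cont_density a b f : a < b ->
  {in `[a, b] &, nondecreasing_fun f} -> abs_cont_on a b f ->
  exists h : R -> R, mu.-integrable setT (EFin \o h) /\
    forall x, a <= x <= b -> f x - f a = (\int[mu]_(y in `]a, x]) h y)%R.
Proof.
move=> ab ndf fac.
(* The projection of the line onto [[a, b]]; [f] composed with it is a continuous nondecreasing
   function on the whole line, as a cumulative function must be. *)
pose cl (x : R) := if x < a then a else if b < x then b else x.
have cl_ab x : a <= cl x <= b.
  by rewrite /cl; case: (ltP x a); case: (ltP b x); move: ab; lra.
have cl_nd x y : x <= y -> cl x <= cl y.
  by rewrite /cl; case: (ltP x a); case: (ltP b x); case: (ltP y a); case: (ltP b y); move: ab; lra.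
have cl_id x : a <= x <= b -> cl x = x.
  by rewrite /cl; case: (ltP x a); case: (ltP b x); lra.
have cl_lip x y : `|cl x - cl y| <= `|x - y|.
  wlog : x y / x <= y.
    by move=> H; case: (leP x y) => [/H//|/ltW/H]; rewrite distrC (distrC y).
  move=> xy; rewrite distrC ger0_norm ?subr_ge0 ?cl_nd// distrC ger0_norm ?subr_ge0//.
  by rewrite /cl; case: (ltP x a); case: (ltP b x); case: (ltP y a); case: (ltP b y); move: ab; lra.
pose F x := f (cl x).
have ndF : nondecreasing_fun F.
  by move=> x y xy; apply: ndf; rewrite ?in_itv/= ?cl_ab//; exact: cl_nd.
have cF : continuous F.
  move=> x; apply/cvgrPdist_lt => e e0.
  have [d d0 H] := abs_cont_on_unif_cont fac e0.
  exists d => //= y xy; apply: H => //.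
  exact: le_lt_trans xy.
pose Fc : cumulative R R := HB.pack F (isCumulative.Build R _ R F ndF (right_continuousW cF)).
pose nu0 : {measure set (measurableTypeR R) -> \bar R} := lebesgue_stieltjes_measure Fc.
have nu0E x y : x <= y -> nu0 `]x, y]%classic = (F y - F x)%:E.
  move=> xy; transitivity (wlength Fc `]x, y]); last by rewrite wlength_itv_bnd.
  exact: (measurable_mu_extE (wlength Fc) (is_ocitv x y)).
have mab : measurable (`]a, b]%classic : set (measurableTypeR R)) by exact: measurable_itv.
have nu0ab : (nu0 `]a, b]%classic < +oo)%E by rewrite nu0E ?ltW// ltry.
(* Restriction to []a, b]] provides a finite measure and matches the set bounded in
   [open_grid_measure]. *)
pose nu : {finite_measure set (measurableTypeR R) -> \bar R} := mfrestr mab nu0ab.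
have nuE A : nu A = nu0 (A `&` `]a, b]) by [].
have dom : nu `<< mu.
  apply/null_content_dominatesP => A mA A0.
  apply/eqP; rewrite eq_le measure_ge0 andbT.
  apply/lee_addgt0Pr => e e0; rewrite add0e.
  have [d d0 H] := fac e e0.
  have [|U [oU AU AUd]] := lebesgue_regularity_outer mA _ d0; first by rewrite A0 ltry.
  have mU : measurable (U : set (measurableTypeR R)) by exact: open_measurable.
  have muU : (mu U < d%:E)%E.
    rewrite -(setDKU AU); apply: le_lt_trans AUd.
    apply: (le_trans (measureU2 _ _ _)) => //; first exact: measurableD.
    by rewrite A0 adde0.
  rewrite nuE; apply: le_trans (@open_grid_measure _ a b ab nu0 F d e U nu0E _ oU muU).
    by apply: le_measure; rewrite ?inE; [exact: measurableI..|exact: setSI].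
  move=> n u v uv vu lend; have FE k : (k < n)%N -> F (v k) = f (v k) /\ F (u k) = f (u k).
    move=> kn; have [auk [uvk vkb]] := uv k kn.
    by rewrite /F !cl_id// ?auk ?vkb ?(le_trans auk uvk) ?(le_trans uvk vkb).
  rewrite (eq_bigr (fun k : 'I_n => `|f (v k) - f (u k)|)); last first.
    by move=> k _; have [-> ->] := FE k (ltn_ord k).
  exact: H.
have [h [h0 hfin hint hE]] := radon_nikodym_sigma_finite dom.
exists (fine \o h).
have hEfin : EFin \o (fine \o h) = h.
  by apply/funext => x /=; rewrite fineK.
split; first by rewrite hEfin.
move=> x /andP[ax xb]; rewrite /Rintegral.
have -> : (\int[mu]_(y in `]a, x]) ((fine \o h) y)%:E)%E = nu `]a, x]%classic.
  by rewrite hE; [apply: eq_integral => y _; rewrite /= fineK|exact: measurable_itv].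
rewrite nuE (_ : `]a, x] `&` `]a, b] = `]a, x])%classic; last first.
  apply/setIidPl => y; rewrite /= !in_itv/= => /andP[-> yx] /=.
  exact: le_trans yx xb.
by rewrite nu0E//= /F !cl_id// ?lexx ?ax ?xb// ltW.
Qed.

End abs_cont_density.

(** * Fundamental theorem of calculus for absolutely continuous functions *)

Section abs_cont_FTC.
Context {R : realType}.
Notation mu := (@lebesgue_measure R).
Implicit Types (a b : R) (f g : R -> R).

Lemma abs_cont_onD a b f g : abs_cont_on a b f -> abs_cont_on a b g ->
  abs_cont_on a b (f \+ g).
Proof.
move=> fac gac e e0; have e2 : 0 < e / 2 by rewrite divr_gt0.
have [d d0 Hf] := fac _ e2; have [d' d'0 Hg] := gac _ e2.
exists (Num.min d d'); first by rewrite lt_min d0.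
move=> n u v uv vu; rewrite lt_min => /andP[ld ld'].
rewrite [e]splitr; apply: le_lt_trans (ltrD (Hf n u v uv vu ld) (Hg n u v uv vu ld')).
rewrite -big_split/=; apply: ler_sum => k _.
by rewrite opprD addrACA; exact: ler_normD.
Qed.

Lemma abs_cont_on_bounded a b f : a <= b -> abs_cont_on a b f ->
  exists2 M, 0 < M & forall x, a <= x <= b -> `|f x| <= M.
Proof.
move=> ab fac; have BVf := abs_cont_on_bounded_variation ab fac.
have Tfin : total_variation a b f \is a fin_num by exact/bounded_variationP.
exists (1 + (`|f a| + fine (total_variation a b f))).
  by rewrite ltr_pwDl// addr_ge0// fine_ge0// total_variation_ge0.
move=> x /andP[ax xb].
apply: (@le_trans _ _ (`|f a| + fine (total_variation a b f))); last by rewrite lerDr.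
have -> : f x = f a + (f x - f a) by rewrite addrC subrK.
apply: (le_trans (ler_normD _ _)); rewrite lerD2l -lee_fin fineK//.
rewrite (total_variationD f ax xb); apply: (le_trans (total_variation_ge f ax)).
by rewrite leeDl// total_variation_ge0.
Qed.

Lemma abs_cont_onM a b f g : a <= b -> abs_cont_on a b f -> abs_cont_on a b g ->
  abs_cont_on a b (f \* g).
Proof.
move=> ab fac gac e e0.
have [M M0 fM] := abs_cont_on_bounded ab fac.
have [N N0 gN] := abs_cont_on_bounded ab gac.
have eN : 0 < e / 2 / N by rewrite !divr_gt0.
have eM : 0 < e / 2 / M by rewrite !divr_gt0.
have [d d0 Hf] := fac _ eN; have [d' d'0 Hg] := gac _ eM.
exists (Num.min d d'); first by rewrite lt_min d0.
move=> n u v uv vu; rewrite lt_min => /andP[ld ld'].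
have {}Hf := Hf n u v uv vu ld; have {}Hg := Hg n u v uv vu ld'.
rewrite ltr_pdivlMr// mulrC in Hf; rewrite ltr_pdivlMr// mulrC in Hg.
rewrite [e]splitr; apply: le_lt_trans (ltrD Hf Hg).
rewrite !mulr_sumr -big_split/=; apply: ler_sum => k _.
have [auk [uvk vkb]] := uv k (ltn_ord k).
have -> : f (v k) * g (v k) - f (u k) * g (u k) =
  g (v k) * (f (v k) - f (u k)) + f (u k) * (g (v k) - g (u k)) by ring.
apply: (le_trans (ler_normD _ _)); rewrite !normrM lerD// ler_wpM2r//.
  by apply: gN; rewrite (le_trans auk uvk).
by apply: fM; rewrite auk (le_trans uvk vkb).
Qed.

Lemma lipschitz_abs_cont_on a b f (k : R) :
  (forall x y, a <= x -> x <= y -> y <= b -> `|f y - f x| <= k * (y - x)) ->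
  abs_cont_on a b f.
Proof.
move=> flip e e0; have k1 : 0 < `|k| + 1 by rewrite ltr_wpDl.
exists (e / (`|k| + 1)); first by rewrite divr_gt0.
move=> n u v uv vu; rewrite ltr_pdivlMr// mulrC mulr_sumr.
apply: le_lt_trans; apply: ler_sum => i _.
have [aui [uvi vib]] := uv i (ltn_ord i).
apply: (le_trans (flip _ _ aui uvi vib)); rewrite ler_wpM2r ?subr_ge0//.
by rewrite (le_trans (ler_norm _))// lerDl.
Qed.

Lemma abs_cont_FTC a b f : a < b -> abs_cont_on a b f ->
  exists h : R -> R, [/\ mu.-integrable `[a, b] (EFin \o h),
    {ae mu, forall x, a < x < b -> is_derive x 1 f (h x)} &
    (\int[mu]_(x in `[a, b]) (h x)%:E = (f b - f a)%:E)%E].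
Proof.
move=> ab fac; have leab := ltW ab.
have BVf := abs_cont_on_bounded_variation leab fac.
pose T x := fine (total_variation a x f).
have Tac : abs_cont_on a b T := abs_cont_on_total_variation leab fac.
have TD x y : a <= x -> x <= y -> y <= b -> `|f y - f x| <= T y - T x.
  move=> ax xy yb; rewrite -lee_fin (le_trans (total_variation_ge f xy))//.
  have fin z w : a <= z -> z <= w -> w <= b -> total_variation z w f \is a fin_num.
    move=> az zw wb; apply/bounded_variationP => //.
    exact/(bounded_variationl zw wb)/(bounded_variationr az (le_trans zw wb)).
  rewrite /T (total_variationD f ax xy) fineD ?fin//; last exact: le_trans yb.
  by rewrite addrAC subrr add0r fineK// fin.
have ndT : {in `[a, b] &, nondecreasing_fun T}.
  move=> x y; rewrite !in_itv/= => /andP[ax _] /andP[_ yb] xy.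
  by rewrite -subr_ge0 (le_trans _ (TD _ _ ax xy yb)).
have ndTf : {in `[a, b] &, nondecreasing_fun (T \+ f)}.
  move=> x y; rewrite !in_itv/= => /andP[ax _] /andP[_ yb] xy.
  have := TD _ _ ax xy yb; rewrite ler_norml => /andP[+ _].
  by rewrite /=; lra.
have [p [pint pE]] := nondecreasing_abs_cont_density ab ndTf (abs_cont_onD Tac fac).
have [q [qint qE]] := nondecreasing_abs_cont_density ab ndT Tac.
(* Lebesgue differentiation, to be applied to the densities [p] of [T + f] and [q] of [T]
   separately. *)
have FTCae h : mu.-integrable setT (EFin \o h) ->
    {ae mu, forall x, a < x -> is_derive x 1 (fun y => \int[mu]_(t in `]a, y]) h t)%R (h x)}.
  move=> hint.
  have intS y : mu.-integrable [set` Interval (BRight a) (BRight y)] (EFin \o h).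
    by apply: integrableS hint => //; exact: measurable_itv.
  have hloc : locally_integrable [set: R] h.
    by apply: open_integrable_locally => //; exact: openT.
  apply: filterS (FTC1 intS hloc); first exact: (ae_filter_ringOfSetsType mu).
  move=> x H ax.
  have [|dx Dx] := H _; first by rewrite /= lte_fin.
  by rewrite -Dx derive1E; exact/derivableP.
exists (fun x => p x - q x).
have intpq : mu.-integrable setT (EFin \o (fun x => p x - q x)).
  rewrite [X in integrable _ _ X](_ : _ = ((EFin \o p) \- (EFin \o q))%E) //.
  exact: integrableB.
split.
- by apply: integrableS intpq => //; exact: measurable_itv.
- apply: filterS2 (FTCae _ pint) (FTCae _ qint).
    exact: (ae_filter_ringOfSetsType mu).
  move=> x Hp Hq /andP[ax xb].
  have {}Hp := Hp ax; have {}Hq := Hq ax.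
  (* Near an interior point, [f] is [f a] plus the difference of the two indefinite integrals, since
     the increments of [T] cancel. *)
  apply: (@near_eq_is_derive _ _ _ (fun y => f a +
      ((\int[mu]_(t in `]a, y]) p t)%R - (\int[mu]_(t in `]a, y]) q t)%R))).
    near=> y; rewrite -pE -?qE ?/=; first by ring.
      by apply/andP; split; apply/ltW; near: y; [exact: lt_nbhsr|exact: lt_nbhsl].
    by apply/andP; split; apply/ltW; near: y; [exact: lt_nbhsr|exact: lt_nbhsl].
  have := is_deriveD (is_derive_cst (f a) x 1) (is_deriveB Hp Hq).
  by rewrite add0r.
- have mI : measurable (`]a, b]%classic : set (measurableTypeR R)) by exact: measurable_itv.
  have pI : mu.-integrable `]a, b] (EFin \o p) by apply: integrableS pint.
  have qI : mu.-integrable `]a, b] (EFin \o q) by apply: integrableS qint.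
  have bab : a <= b <= b by rewrite leab lexx.
  rewrite -integral_itv_obnd_cbnd; last first.
    by case/integrableP: (integrableS measurableT mI (@subsetT _ _) intpq).
  under eq_integral do rewrite EFinB.
  rewrite integralB_EFin//.
  move: (pE b bab) (qE b bab); rewrite /Rintegral => pb qb.
  rewrite -(fineK (integrable_fin_num _ pI))// -(fineK (integrable_fin_num _ qI))//=.
  by rewrite -pb -qb -EFinB /=; congr EFin; ring.
Unshelve. all: by end_near. Qed.

End abs_cont_FTC.

(** * Calculus *)

Section calculus.
Context {R : realType}.
Notation mu := (@lebesgue_measure R).

Import HBNNSimple.

(** The function [f] is arbitrary, so that the entropy of any competitor can be inserted without
    discussing its measurability. The argument therefore works with the definition of the integral
    as a supremum over simple functions. *)
Lemma le_integral_ae (D : set (measurableTypeR R)) (f : R -> \bar R) (h : R -> R) :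
  measurable D -> mu.-integrable D (EFin \o h) ->
  {ae mu, forall x, D x -> (0 <= f x)%E /\ ((h x)%:E <= f x)%E} ->
  (\int[mu]_(x in D) (h x)%:E <= \int[mu]_(x in D) f x)%E.
Proof.
move=> mD hint [N [mN N0 Nsub]].
have fN x : D x -> ~ N x -> (0 <= f x)%E /\ ((h x)%:E <= f x)%E.
  by move=> Dx nNx; apply: contrapT => nf; apply: nNx; apply: Nsub => /(_ Dx).
have mDN : measurable (D `\` N) by exact: measurableD.
have hDN : mu.-integrable (D `\` N) (EFin \o h).
  by apply: integrableS hint => //; exact: subDsetl.
rewrite (negligible_integral mN mD hint N0).
(* Off the null set [N] the function [h] may be replaced by its positive part. *)
apply: (@le_trans _ _ (\int[mu]_(x in D `\` N) ((EFin \o h) ^\+ x))%E).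
  rewrite [leLHS]integralE/= leeBlDr; last exact: integrable_neg_fin_num.
  by rewrite leeDl// integral_ge0.
rewrite ge0_integralE// [leRHS]/integral.
(* The integral of the negative part of [f]. A simple function below it vanishes outside [N], so its
   integral is 0. *)
set s3 := (X in (_ <= _ - X)%E).
have -> : s3 = 0%E.
  apply/eqP; rewrite eq_le; apply/andP; split; last first.
    apply: ereal_sup_ubound => /=; exists (@nnsfun0 _ _ _); last exact: sintegral0.
    by move=> x; exact: funeneg_ge0.
  apply: ge_ereal_sup => _ [s /= sle <-].
  rewrite -integralT_nnsfun (@ae_eq_integral _ _ _ _ _ (cst 0%E))//.
  - by rewrite integral0.
  - exact/measurable_EFinP.
  - exists N; split => // x /= /not_implyP[_ sx]; apply: contrapT => nNx.
    apply: sx; apply/eqP; rewrite eq_le; apply/andP; split; last first.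
      by rewrite lee_fin.
    apply: (le_trans (sle x)); rewrite funenegE patchE.
    case: ifPn => [|_]; last by rewrite oppe0 maxxx.
    by rewrite inE => Dx; rewrite ge_max lexx andbT leeNl oppe0; have [] := fN x Dx nNx.
(* Every simple function below the positive part of [h] on the complement of [N] in [D] is also
   below the positive part of [f] on [D]. *)
rewrite sube0; apply: le_ereal_sup => _ [s /= sle <-]; exists s => //= x.
apply: (le_trans (sle x)); rewrite !patchE !funeposE.
case: ifPn; last by rewrite patchE le_max lexx orbT.
rewrite inE => -[Dx nNx]; rewrite patchE mem_set//.
by rewrite ge_max !le_max lexx !orbT andbT; have [_ ->] := fN x Dx nNx.
Qed.

Lemma is_derive_add (f g : R -> R) (x df dg : R) :
  is_derive x 1 f df -> is_derive x 1 g dg ->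
  is_derive x 1 (fun y => f y + g y) (df + dg).
Proof. exact: is_deriveD. Qed.

Lemma is_derive_sub (f g : R -> R) (x df dg : R) :
  is_derive x 1 f df -> is_derive x 1 g dg ->
  is_derive x 1 (fun y => f y - g y) (df - dg).
Proof. exact: is_deriveB. Qed.

Lemma is_derive_mul (f g : R -> R) (x df dg : R) :
  is_derive x 1 f df -> is_derive x 1 g dg ->
  is_derive x 1 (fun y => f y * g y) (f x * dg + g x * df).
Proof. exact: is_deriveM. Qed.

Lemma is_derive_scale (c : R) (f : R -> R) (x df : R) :
  is_derive x 1 f df -> is_derive x 1 (fun y => c * f y) (c * df).
Proof.
move=> fx; have := is_derive_mul (is_derive_cst c x 1) fx.
by rewrite mulr0 addr0.
Qed.

Lemma is_derive_bigsum n (f : nat -> R -> R) (x : R) (df : nat -> R) :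
  (forall i, (i < n)%N -> is_derive x 1 (f i) (df i)) ->
  is_derive x 1 (fun y => \sum_(i < n) f i y) (\sum_(i < n) df i).
Proof.
move=> fdf; rewrite (_ : (fun y => _) = \sum_(i < n) f i); last first.
  by apply/funext => y; rewrite fct_sumE.
by apply: is_derive_sum => i; exact: fdf.
Qed.

Lemma is_derive_pow n (f : R -> R) (x df : R) : is_derive x 1 f df ->
  is_derive x 1 (fun y => f y ^+ n) (n%:R * f x ^+ n.-1 * df).
Proof.
move=> fx; rewrite (_ : (fun y => _) = f ^+ n); first exact: is_deriveX.
by apply/funext => y; rewrite exprfctE.
Qed.

Lemma is_derive_ln_comp (f : R -> R) (x df : R) : 0 < f x -> is_derive x 1 f df ->
  is_derive x 1 (fun y => ln (f y)) (df / f x).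
Proof. by move=> /is_derive1_ln lnx fx; rewrite mulrC; exact: is_derive1_comp. Qed.

Lemma is_derive_continuous (f : R -> R) (x df : R) : is_derive x 1 f df ->
  {for x, continuous f}.
Proof. by move=> fx; apply: differentiable_continuous; apply/derivable1_diffP; case: fx. Qed.

Lemma continuous_bigsum n (f : nat -> R -> R) (x : R) :
  (forall i, (i < n)%N -> {for x, continuous (f i)}) ->
  {for x, continuous (fun y => \sum_(i < n) f i y)}.
Proof.
elim: n => [|n IH] cf.
  rewrite (_ : (fun y => _) = (fun=> 0)); first exact: cst_continuous.
  by apply/funext => y; rewrite big_ord0.
rewrite (_ : (fun y => _) = (fun y => \sum_(i < n) f i y + f n y)); last first.
  by apply/funext => y; rewrite big_ord_recr.
by apply: continuousD; [apply: IH => i /ltnW; exact: cf|exact: cf].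
Qed.

Lemma is_derive_MVT (f df : R -> R) (a b : R) : a < b ->
  (forall x, a <= x <= b -> is_derive x 1 f (df x)) ->
  exists2 c, a < c < b & f b - f a = df c * (b - a).
Proof.
move=> ab fdf; have [c|c|c cab ->] := @MVT _ f df a b ab.
- by rewrite in_itv/= => /andP[ac cb]; apply: fdf; rewrite !ltW.
- apply: derivable_within_continuous => x; rewrite in_itv/= => xab.
  by case: (fdf _ xab).
- by exists c => //; rewrite in_itv/= in cab.
Qed.

(** The derivative attains a maximal modulus on the segment, so the mean value theorem makes [f]
    Lipschitz. *)
Lemma C1_abs_cont_on (f df : R -> R) (a b : R) : a <= b ->
  (forall x, a <= x <= b -> is_derive x 1 f (df x)) ->
  (forall x, a <= x <= b -> {for x, continuous df}) ->
  abs_cont_on a b f.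
Proof.
move=> ab fdf cdf.
have cdfn : {within `[a, b], continuous (fun x => `|df x|)}.
  apply/continuous_in_subspaceT => x; rewrite inE/= in_itv/= => xab.
  by apply: cvg_norm; exact: cdf.
have [c _ cmax] := EVT_max ab cdfn.
apply: (@lipschitz_abs_cont_on _ _ _ _ `|df c|) => x y ax.
rewrite le_eqVlt => /predU1P[<-|xy] yb; first by rewrite !subrr normr0 mulr0.
have [z|z /andP[xz zy] ->] := @is_derive_MVT f df x y xy.
  by move=> /andP[xz zy]; apply: fdf; rewrite (le_trans ax xz) (le_trans zy yb).
rewrite normrM (@ger0_norm _ (y - x)) ?subr_ge0 ?(ltW xy)// ler_wpM2r ?subr_ge0 ?(ltW xy)//.
by apply: cmax; rewrite in_itv/= (le_trans ax (ltW xz)) (le_trans (ltW zy) yb).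
Qed.

Lemma ae_itvoo (a b : R) : {ae mu, forall x, a <= x <= b -> a < x < b}.
Proof.
exists ([set a] `|` [set b]); split.
- exact: measurableU.
- by rewrite measureU0//; exact: lebesgue_measure_set1.
- move=> x /= nx; apply: contrapT => /not_orP[xa xb]; apply: nx => /andP[ax xb'].
  rewrite !lt_neqAle ax xb' !andbT; apply/andP; split; last exact/eqP.
  by rewrite eq_sym; exact/eqP.
Qed.

End calculus.

(** * The dual bound *)

Section dual.
Context {R : realType}.
Notation mu := (@lebesgue_measure R).

Lemma abs_cont_on_cst (a b c : R) : abs_cont_on a b (fun=> c).
Proof.
by apply: (@lipschitz_abs_cont_on _ _ _ _ 0) => x y _ _ _; rewrite subrr normr0 mul0r.
Qed.

Lemma abs_cont_on_id (a b : R) : abs_cont_on a b id.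
Proof.
apply: (@lipschitz_abs_cont_on _ _ _ _ 1) => x y _ xy _.
by rewrite mul1r ger0_norm// subr_ge0.
Qed.

Lemma abs_cont_on_sum (a b : R) n (f : nat -> R -> R) :
  (forall i, (i < n)%N -> abs_cont_on a b (f i)) ->
  abs_cont_on a b (fun x => \sum_(i < n) f i x).
Proof.
elim: n => [|n IH] fac.
  rewrite (_ : (fun x => _) = (fun=> 0)); first exact: abs_cont_on_cst.
  by apply/funext => x; rewrite big_ord0.
rewrite (_ : (fun x => _) = (fun x => \sum_(i < n) f i x + f n x)); last first.
  by apply/funext => x; rewrite big_ord_recr.
by apply: abs_cont_onD; [apply: IH => i /ltnW; exact: fac|exact: fac].
Qed.

Lemma psiE I (g : 'I_I.+2 -> R -> R) i x : (i < I.+2)%N ->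
  psi g i x = \sum_(j < i.+1) g (inord j) x.
Proof.
move=> iI; rewrite (big_ord_widen _ (fun j => g (inord j) x) iI) /psi.
by apply: eq_big => // j _; rewrite inord_val.
Qed.

Lemma mean_ballsE I (omega : 'I_I.+2 -> R) :
  mean_balls omega = \sum_(j < I.+2) j%:R * omega (inord j).
Proof.
rewrite /mean_balls big_mkord [RHS]big_ord_recr/=; congr (_ + _ * omega _).
by apply/val_inj; rewrite /= inordK.
Qed.

(** Summation by parts. The sign is chosen so that, when [c] lists the derivatives of the
    occupancies, the coefficients are the rates [theta_j]. *)
Lemma abel_sum n (c u : nat -> R) :
  \sum_(j < n.+1) c j * u j =
  \sum_(j < n) (- \sum_(k < j.+1) c k) * (u j.+1 - u j) +
  (\sum_(j < n.+1) c j) * u n.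
Proof.
elim: n => [|n IH]; first by rewrite big_ord0 !big_ord_recr !big_ord0/= !add0r.
by rewrite big_ord_recr/= IH [in RHS]big_ord_recr/= [in X in _ = _ + X]big_ord_recr/=; ring.
Qed.

(* Summation by parts; [t j] is the rate [theta_j] of the path [G]. *)
Lemma potential_derive n (G U : nat -> R -> R) (c q : nat -> R) (x k L : R) :
  (forall j, (j < n.+1)%N -> is_derive x 1 (G j) (c j)) ->
  (forall j, (j < n.+1)%N -> is_derive x 1 (U j) (- q j)) ->
  \sum_(j < n.+1) c j = 0 ->
  let t j := - \sum_(i < j.+1) c i in
  is_derive x 1 (fun y => k * y + \sum_(j < n.+1) G j y * U j y +
                          L * (y - \sum_(j < n.+1) j%:R * G j y))
    (k + (\sum_(j < n) t j * (U j.+1 x - U j x) - \sum_(j < n.+1) q j * G j x) +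
     L * (1 - \sum_(j < n) t j)).
Proof.
move=> dG dU c0 t.
(* Summation by parts with [u j = j], whose increments are 1: the mean number of balls grows at the
   total rate of the first [n] components. *)
have Ht : \sum_(j < n.+1) j%:R * c j = \sum_(j < n) t j.
  under eq_bigr do rewrite mulrC.
  rewrite abel_sum c0 mul0r addr0; apply: eq_bigr => j _.
  by rewrite -natr1 addrAC subrr add0r mulr1.
have HG : \sum_(j < n.+1) (G j x * - q j + U j x * c j) =
    \sum_(j < n) t j * (U j.+1 x - U j x) - \sum_(j < n.+1) q j * G j x.
  rewrite big_split/= addrC; congr (_ + _).
    under eq_bigr do rewrite mulrC.
    by rewrite (abel_sum n c (fun j => U j x)) c0 mul0r addr0.
  by rewrite -sumrN; apply: eq_bigr => j _; rewrite mulrN mulrC.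
rewrite -HG -Ht.
apply: is_derive_add; first apply: is_derive_add.
- by have := is_derive_scale k (is_derive_id x 1); rewrite mulr1.
- apply: (is_derive_bigsum (f := fun j y => G j y * U j y)
    (df := fun j => G j x * - q j + U j x * c j)) => j jn.
  by apply: is_derive_mul; [exact: dG|exact: dU].
- apply/is_derive_scale/(is_derive_sub (is_derive_id x (1 : R))).
  apply: (is_derive_bigsum (f := fun j y => j%:R * G j y) (df := fun j => j%:R * c j)) => j jn.
  by apply: is_derive_scale; exact: dG.
Qed.

(** With [s = r g / t] the difference of the two sides is [t (s - 1 - ln s)], which is nonnegative
    and vanishes for [t = r g]. The degenerate cases follow the conventions of [ent_term]. *)
Lemma ent_term_ge (t g r : R) : 0 <= t -> 0 <= g -> 0 < r ->
  ((t * ln r + t - r * g)%:E <= ent_term t g)%E.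
Proof.
move=> t0 g0 r0; rewrite /ent_term; case: (leP t 0) => [t0'|tp].
  have -> : t = 0 by apply/eqP; rewrite eq_le t0 t0'.
  by rewrite lee_fin mul0r !add0r oppr_le0 mulr_ge0// ltW.
case: (leP g 0) => [_|gp]; first by rewrite leey.
have s0 : 0 < r * g / t by rewrite divr_gt0// mulr_gt0.
have s1 : -1 < r * g / t - 1 by lra.
have := le_ln1Dx s1; rewrite addrC subrK.
have -> : r * g / t = r / (t / g) by rewrite invf_div mulrA.
rewrite ln_div ?posrE// ?divr_gt0// => lnle.
rewrite lee_fin -subr_ge0.
have -> : t * ln (t / g) - (t * ln r + t - r * g) =
  t * (r / (t / g) - 1 - (ln r - ln (t / g))).
  by field; rewrite ?gt_eqF.
by rewrite mulr_ge0// subr_ge0.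
Qed.

Lemma rel_ent_ge I (t g r : 'I_I.+2 -> R) : (forall j, 0 <= t j) ->
  (forall j, 0 <= g j) -> (forall j, 0 < r j) ->
  ((\sum_(j < I.+2) (t j * ln (r j) + t j - r j * g j))%:E <= rel_ent t g)%E.
Proof.
by move=> t0 g0 r0; rewrite -sumEFin; apply: lee_sum => j _; exact: ent_term_ge.
Qed.

(** With all multipliers equal to 1 the lower bound is the difference of the two total masses, which
    is 0. *)
Lemma rel_ent_ge0 I (t g : 'I_I.+2 -> R) : simplex t -> simplex g ->
  (0 <= rel_ent t g)%E.
Proof.
move=> [t0 t1] [g0 g1]; apply: le_trans (rel_ent_ge t0 g0 (fun=> ltr01)).
rewrite lee_fin ln1; under eq_bigr do rewrite mulr0 add0r mul1r.
by rewrite big_split/= sumrN t1 g1 subrr.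
Qed.

End dual.

(** * The dual bound for a positive system *)

Section dual_bound.
Context {R : realType}.
Notation mu := (@lebesgue_measure R).

Lemma theta_derive I (g : 'I_I.+2 -> R -> R) (c : nat -> R) (x : R) :
  (forall j, (j < I.+1)%N -> is_derive x 1 (g (inord j)) (c j)) ->
  let t j := - \sum_(k < j.+1) c k in
  (forall j, (j < I.+1)%N -> theta g (inord j) x = t j) /\
  theta g (Iplus I) x = 1 - \sum_(j < I.+1) t j.
Proof.
move=> gc t.
have dpsi j : (j < I.+1)%N -> - derive1 (psi g j) x = t j.
  move=> jI; rewrite derive1E (_ : psi g j = fun y => \sum_(k < j.+1) g (inord k) y); last first.
    by apply/funext => y; rewrite psiE// ltnW.
  congr (- _); apply: derive_val.
  apply: (is_derive_bigsum (f := fun k y => g (inord k) y)) => k kj.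
  by apply: gc; apply: leq_trans jI.
split.
  by move=> j jI; rewrite /theta inordK; [rewrite ifT ?dpsi|exact: ltnW].
rewrite /theta/= ltnn; congr (1 - _).
rewrite [RHS](big_ord_widen _ t (leqnSn I.+1)).
by apply: eq_big => [j|j jI]; [rewrite ltnS|exact: dpsi].
Qed.

(** The entropy is bounded below with the multipliers [F_(j+1) / F_j] for [j <= I] and [rho] for the
    last component, where [rho] is positive even if [r = 0]. The drift [1 - (rho - r)] in the
    potential [Phi] absorbs the mismatch between [rho] and [r], at the cost [(rho - r) * beta],
    which disappears as [rho] tends to [r]. *)
Lemma dual_bound I (beta : R) (omega : 'I_I.+2 -> R) (g : 'I_I.+2 -> R -> R) (F : nat -> R -> R) (r rho : R) :
  0 < beta -> 0 < rho -> r <= rho ->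
  (forall j (x : R), is_derive x 1 (F j) (- F j.+1 x)) ->
  (forall x, F I.+2 x = r * F I.+1 x) ->
  (forall j x, (j < I.+2)%N -> 0 <= x <= beta -> 0 < F j x) ->
  A_set (@empty_init R I) omega beta g ->
  ((beta + \sum_(j < I.+2) omega (inord j) * ln (F j beta) - ln (F 0 0) +
    (beta - mean_balls omega) * ln rho - (rho - r) * beta)%:E <= J beta g)%E.
Proof.
move=> b0 rho0 rrho dF FI F0 [gv [ginit gend]].
have [gac [gsim thsim]] := gv.
rewrite /J asboolT//.
pose G j := g (inord j : 'I_I.+2).
pose U j y := ln (F j y).
pose q j y := F j.+1 y / F j y.
have dU j x : (j < I.+2)%N -> 0 <= x <= beta -> is_derive x 1 (U j) (- q j x).
  by move=> jI xb; rewrite /q -mulNr; apply: is_derive_ln_comp => //; exact: F0.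
have Uac j : (j < I.+2)%N -> abs_cont_on 0 beta (U j).
  move=> jI; apply: (C1_abs_cont_on (df := fun x => - q j x)); first exact: ltW.
    by move=> x; exact: dU.
  move=> x xb; apply: cvgN; apply: cvgM; first exact: is_derive_continuous (dF _ _).
  by apply: cvgV; [rewrite gt_eqF//; exact: F0|exact: is_derive_continuous (dF _ _)].
pose Phi y := (1 - (rho - r)) * y + \sum_(j < I.+2) G j y * U j y +
  ln rho * (y - \sum_(j < I.+2) j%:R * G j y).
have Phiac : abs_cont_on 0 beta Phi.
  have lb := ltW b0.
  apply: abs_cont_onD; first apply: abs_cont_onD.
  - exact: (abs_cont_onM lb (abs_cont_on_cst _ _ _) (@abs_cont_on_id _ _ _)).
  - apply: (abs_cont_on_sum (f := fun j y => G j y * U j y)) => j jI.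
    exact: (abs_cont_onM lb (gac _) (Uac _ jI)).
  - apply: (abs_cont_onM lb (abs_cont_on_cst _ _ _)).
    apply: (abs_cont_onD (@abs_cont_on_id _ _ _)).
    rewrite (_ : (fun x => _) = (fun x => -1 * (\sum_(j < I.+2) j%:R * G j x))); last first.
      by apply/funext => x; rewrite mulN1r.
    apply: (abs_cont_onM lb (abs_cont_on_cst _ _ _)).
    apply: (abs_cont_on_sum (f := fun j y => j%:R * G j y)) => j jI.
    exact: (abs_cont_onM lb (abs_cont_on_cst _ _ _) (gac _)).
have [h [hint hder hE]] := abs_cont_FTC b0 Phiac.
have -> : beta + \sum_(j < I.+2) omega (inord j) * ln (F j beta) - ln (F 0%N 0) +
    (beta - mean_balls omega) * ln rho - (rho - r) * beta = Phi beta - Phi 0.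
  (* At time 0 all mass is in component 0, so a single term survives. *)
  have -> : Phi 0 = ln (F 0%N 0).
    have z (j : 'I_I.+1) : G (lift ord0 j) 0 = 0.
      rewrite /G ginit /empty_init -val_eqE/= inordK//.
      by rewrite /bump/= add1n ltnS.
    have z0 : G 0%N 0 = 1.
      rewrite /G ginit /empty_init (_ : inord 0 = ord0) ?eqxx//.
      by apply/val_inj; rewrite /= inordK.
    rewrite /Phi mulr0 add0r sub0r.
    have -> : \sum_(j < I.+2) G j 0 * U j 0 = ln (F 0%N 0).
      by rewrite big_ord_recl/= z0 mul1r big1 ?addr0// => j _; rewrite z mul0r.
    have -> : \sum_(j < I.+2) j%:R * G j 0 = 0.
      by rewrite big_ord_recl/= mul0r add0r big1// => j _; rewrite z mulr0.
    by rewrite oppr0 mulr0 addr0.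
  rewrite /Phi mean_ballsE.
  have -> : \sum_(j < I.+2) G j beta * U j beta = \sum_(j < I.+2) omega (inord j) * ln (F j beta).
    by apply: eq_bigr => j _; rewrite /G gend.
  have -> : \sum_(j < I.+2) j%:R * G j beta = \sum_(j < I.+2) j%:R * omega (inord j).
    by apply: eq_bigr => j _; rewrite /G gend.
  ring.
rewrite -hE; apply: (le_integral_ae (measurable_itv `[0, beta]) hint).
(* The competitor is only absolutely continuous; its derivatives exist almost everywhere,
   simultaneously for all components. *)
have gder : {ae mu, forall x, forall j : nat, 0 < x < beta -> derivable (G j) x 1}.
  apply/ae_foralln => j; have [hj [_ + _]] := abs_cont_FTC b0 (gac (inord j)).
  apply: filterS; first exact: (ae_filter_ringOfSetsType mu).
  by move=> x H /H [].
have AEF := ae_filter_ringOfSetsType mu.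
apply: filterS2 (filterI gder thsim) (filterI hder (ae_itvoo 0 beta)) => x [dx thx] [hx itvx].
rewrite /= in_itv/= => x0b; have {}x01 := itvx x0b.
have {}hx := hx x01; have {}thx := thx x0b; have gx := gsim x x0b.
split; first exact: rel_ent_ge0.
pose c j := derive1 (G j) x.
have dGc j : is_derive x 1 (G j) (c j).
  by rewrite /c derive1E; apply/derivableP; exact: dx.
(* The total mass is constantly 1 near the interior point [x]. *)
have c0 : \sum_(j < I.+2) c j = 0.
  have H : is_derive x 1 (fun y => \sum_(j < I.+2) G j y) (\sum_(j < I.+2) c j).
    by apply: (is_derive_bigsum (f := G)) => j _.
  have H1 : is_derive x 1 (fun y => \sum_(j < I.+2) G j y) 0.
    apply: near_eq_is_derive (is_derive_cst (1 : R) x (1 : R)).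
    case/andP : x01 => x0 xb; near=> y.
    have /gsim [_ /esym] : 0 <= y <= beta.
      by apply/andP; split; apply/ltW; near: y; [exact: lt_nbhsr|exact: lt_nbhsl].
    by rewrite /= => ->; apply: eq_bigr => j _; rewrite /G inord_val.
  by rewrite -(@derive_val _ _ _ _ _ _ _ H) (@derive_val _ _ _ _ _ _ _ H1).
have [tE tpE] := theta_derive (fun j _ => dGc j).
have := potential_derive (1 - (rho - r)) (ln rho) (fun j (_ : (j < I.+2)%N) => dGc j)
  (fun j jI => dU j x jI x0b) c0.
move=> /= Hd; have {}hx : h x = _ := esym (@derive_val _ _ _ _ _ _ _ hx).
rewrite hx -/Phi (@derive_val _ _ _ _ _ _ _ Hd).
pose rr (j : 'I_I.+2) := if (j <= I)%N then q j x else rho.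
have rr0 j : 0 < rr j.
  by rewrite /rr; case: ifP => // jI; rewrite /q divr_gt0// F0.
apply: le_trans (rel_ent_ge thx.1 gx.1 rr0).
rewrite lee_fin [leRHS]big_ord_recr/=.
have -> : \sum_(i < I.+1) (theta g (widen_ord (leqnSn I.+1) i) x * ln (rr (widen_ord (leqnSn I.+1) i)) +
   theta g (widen_ord (leqnSn I.+1) i) x - rr (widen_ord (leqnSn I.+1) i) * g (widen_ord (leqnSn I.+1) i) x) =
   \sum_(i < I.+1) (- \sum_(k < i.+1) c k) * (U i.+1 x - U i x) +
   \sum_(i < I.+1) (- \sum_(k < i.+1) c k) - \sum_(i < I.+1) q i x * G i x.
  rewrite -sumrN -!big_split/=; apply: eq_bigr => i _.
  have iI : (i < I.+2)%N by exact: ltnW (ltn_ord i).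
  have -> : widen_ord (leqnSn I.+1) i = inord i.
    by apply/val_inj; rewrite /= inordK.
  rewrite tE// /rr inordK// ifT; last by rewrite -ltnS.
  by rewrite /q /U /G ln_div// posrE; [exact: (F0 i.+1 x (ltn_ord i) x0b)|exact: (F0 i x iI x0b)].
rewrite -/(Iplus I) tpE /rr /= ltnn.
rewrite [X in _ + (_ - X) + _]big_ord_recr/=.
(* The top relation of the system turns the last term of the derivative of [Phi] into [r] times the
   occupancy of [I+]. *)
have -> : q I.+1 x = r by rewrite /q FI mulfK// gt_eqF// F0.
have -> : G I.+1 x = g (Iplus I) x.
  by rewrite /G; congr (g _ x); apply/val_inj; rewrite /= inordK.
have gp1 : g (Iplus I) x <= 1.
  by rewrite -gx.2 (bigD1 (Iplus I))//= lerDl sumr_ge0// => j _; exact: gx.1.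
rewrite -subr_ge0.
set A := \sum_(i < I.+1) _ * _; set B := \sum_(i < I.+1) _; set C := \sum_(i < I.+1) _.
(* The gap between the entropy bound and the derivative of [Phi] is [(rho - r) (1 - gamma_(I+))],
   which is nonnegative. *)
have -> : A + B - C + ((1 - B) * ln rho + (1 - B) - rho * g (Iplus I) x) -
   (1 - (rho - r) + (A - (C + r * g (Iplus I) x)) + ln rho * (1 - B)) =
   (rho - r) * (1 - g (Iplus I) x) by ring.
by rewrite mulr_ge0 ?subr_ge0.
Unshelve. all: by end_near. Qed.

End dual_bound.

(** * The dual bound for a nonnegative system *)

Section dual_bound_limit.
Context {R : realType}.

(* The dual bound extends to nonnegative systems [F] by perturbing [F] with a
   positive system [H]; the convention [ln 0 = 0] is harmless because the
   corresponding weights vanish. *)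
Lemma dual_bound_limit I (beta : R) (omega : 'I_I.+2 -> R) (g : 'I_I.+2 -> R -> R)
    (F H : nat -> R -> R) (r : R) :
  0 < beta -> 0 <= r ->
  (forall j (x : R), is_derive x 1 (F j) (- F j.+1 x)) ->
  (forall x, F I.+2 x = r * F I.+1 x) ->
  (forall j (x : R), (j < I.+2)%N -> 0 <= x <= beta -> 0 <= F j x) ->
  (forall j (x : R), is_derive x 1 (H j) (- H j.+1 x)) ->
  (forall x, H I.+2 x = r * H I.+1 x) ->
  (forall j (x : R), (j < I.+2)%N -> 0 <= x <= beta -> 0 < H j x) ->
  (forall j, (j < I.+2)%N -> omega (inord j) = 0 \/ 0 < F j beta) ->
  F 0 0 = 1 -> 0 < r \/ mean_balls omega = beta ->
  A_set (@empty_init R I) omega beta g ->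
  ((beta + \sum_(j < I.+2) omega (inord j) * ln (F j beta) +
    (beta - mean_balls omega) * ln r)%:E <= J beta g)%E.
Proof.
move=> b0 r0 dF FI F0 dH HI H0 Fbeta F00 rmean gA.
(* The value given by [dual_bound] for the system [F + e H] with [rho = r + e]. *)
pose V e := beta + \sum_(j < I.+2) omega (inord j) * ln (F j beta + e * H j beta)
  - ln (F 0%N 0 + e * H 0%N 0) + (beta - mean_balls omega) * ln (r + e)
  - (r + e - r) * beta.
have bb : 0 <= beta <= beta by rewrite ltW/=.
have VJ e : 0 < e -> ((V e)%:E <= J beta g)%E.
  move=> e0; pose Fe j x := F j x + e * H j x.
  apply: (@dual_bound _ I beta omega g Fe r (r + e)) => //.
  - by rewrite ltr_wpDl.
  - by rewrite lerDl ltW.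
  - move=> j x; rewrite /Fe opprD -mulrN.
    exact: is_derive_add (dF j x) (is_derive_scale e (dH j x)).
  - by move=> x; rewrite /Fe FI HI mulrDr mulrCA.
  - by move=> j x jI xb; rewrite /Fe ltr_wpDl ?F0// mulr_gt0// H0.
(* Each logarithm in [V] is differentiable at [e = 0], either because its argument is positive there
   or because its coefficient is 0. Differentiability of [V] serves only to let [e] tend to 0. *)
have lnD (a h c : R) : c = 0 \/ 0 < a ->
    is_derive (0 : R) 1 (fun e => c * ln (a + e * h)) (c * (h / a)).
  move=> [->|a0].
    rewrite mul0r (_ : (fun e => _) = (fun=> 0)); first exact: is_derive_cst.
    by apply/funext => e; rewrite mul0r.
  apply: is_derive_scale; have -> : h / a = h / (a + 0 * h) by rewrite mul0r addr0.
  apply: is_derive_ln_comp; first by rewrite mul0r addr0.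
  have -> : (fun e => a + e * h) = (fun e => a + h * e) by apply/funext => e; rewrite mulrC.
  have := is_derive_add (is_derive_cst a (0 : R) (1 : R)) (is_derive_scale h (is_derive_id (0 : R) (1 : R))).
  by rewrite mulr1 add0r.
have [d dV] : exists d, is_derive (0 : R) 1 V d.
  eexists; apply: is_derive_sub.
    apply: is_derive_add; first apply: is_derive_sub.
    - apply: (is_derive_add (is_derive_cst beta (0 : R) (1 : R))).
      apply: (is_derive_bigsum (f := fun j e => omega (inord j) * ln (F j beta + e * H j beta))) => j jI.
      exact/lnD/Fbeta.
    - have := lnD (F 0%N 0) (H 0%N 0) 1; rewrite F00 => /(_ (or_intror ltr01)).
      by under [X in is_derive _ _ X]eq_fun do rewrite mul1r; exact.
    - have := lnD r 1 (beta - mean_balls omega) => /(_ _)/=.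
      under [X in is_derive _ _ X]eq_fun do rewrite mulr1.
      by apply; case: rmean => [|->]; [right|left; rewrite subrr].
have V0 : V 0 = beta + \sum_(j < I.+2) omega (inord j) * ln (F j beta) +
    (beta - mean_balls omega) * ln r.
  rewrite /V F00 !mul0r !addr0 ln1 subr0 subrr mul0r subr0; congr (_ + _ + _).
  by apply: eq_bigr => j _; rewrite mul0r addr0.
rewrite -V0; case: (J beta g) VJ => [v VJ| |VJ]; last 2 first.
- by rewrite leey.
- by have := VJ _ ltr01.
rewrite lee_fin.
have cV : V e @[e --> 0^'+] --> V 0.
  exact: cvg_at_right_filter (is_derive_continuous dV).
apply: (cvgr_to_le cV).
by near=> e; rewrite -lee_fin; apply: VJ; near: e; exact: nbhs_right_gt.
Unshelve. all: by end_near. Qed.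

End dual_bound_limit.

(** * The path of a system *)

Section poisson_weight.
Context {R : realType}.

Definition pow_fact (j : nat) (x : R) : R := x ^+ j / j`!%:R.

Lemma pow_fact0 x : pow_fact 0 x = 1.
Proof. by rewrite /pow_fact expr0 fact0 divr1. Qed.

Lemma pow_factS0 j : pow_fact j.+1 0 = 0.
Proof. by rewrite /pow_fact expr0n/= mul0r. Qed.

Lemma pow_fact_ge0 j x : 0 <= x -> 0 <= pow_fact j x.
Proof. by move=> x0; rewrite divr_ge0// exprn_ge0. Qed.

Lemma pow_fact_gt0 j x : 0 < x -> 0 < pow_fact j x.
Proof. by move=> x0; rewrite divr_gt0 ?exprn_gt0// ltr0n fact_gt0. Qed.

Lemma is_derive_pow_factS j (x : R) :
  is_derive x 1 (pow_fact j.+1) (pow_fact j x).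
Proof.
have -> : pow_fact j.+1 = (fun y => (j.+1`!%:R)^-1 * y ^+ j.+1).
  by apply/funext => y; rewrite mulrC.
have -> : pow_fact j x = (j.+1`!%:R)^-1 * (j.+1%:R * x ^+ j * 1).
  rewrite /pow_fact factS natrM; field.
  by rewrite pnatr_eq0 -lt0n fact_gt0 nat1r pnatr_eq0.
exact/is_derive_scale/(is_derive_pow j.+1 (is_derive_id x (1 : R))).
Qed.

Lemma pow_fact_abs_cont a b j : a <= b -> abs_cont_on a b (pow_fact j).
Proof.
move=> ab; apply: (abs_cont_onM ab); last exact: abs_cont_on_cst.
elim: j => [|j IH].
  rewrite (_ : (fun x => _) = (fun=> 1)); first exact: abs_cont_on_cst.
  by apply/funext => x; rewrite expr0.
rewrite (_ : (fun x => _) = (fun x => x * x ^+ j)).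
  exact: (abs_cont_onM ab (@abs_cont_on_id _ _ _)).
by apply/funext => x; rewrite exprS.
Qed.

(* The sum of the derivatives telescopes. *)
Lemma is_derive_sum_pow_fact (E : nat -> R -> R) n (x : R) :
  (forall j (y : R), is_derive y 1 (E j) (- E j.+1 y)) ->
  is_derive x 1 (fun y => \sum_(j < n.+1) pow_fact j y * E j y)
    (- (pow_fact n x * E n.+1 x)).
Proof.
move=> dE; elim: n => [|n IH].
  rewrite (_ : (fun y => _) = E 0%N); first by rewrite pow_fact0 mul1r.
  by apply/funext => y; rewrite big_ord_recr big_ord0/= add0r pow_fact0 mul1r.
rewrite (_ : (fun y => _) = (fun y => \sum_(j < n.+1) pow_fact j y * E j y +
    pow_fact n.+1 y * E n.+1 y)); last by apply/funext => y; rewrite big_ord_recr.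
have := is_derive_add IH (is_derive_mul (is_derive_pow_factS n x) (dE n.+1 x)).
by congr is_derive; ring.
Qed.

End poisson_weight.

(* [F j] plays the role of [(-1)^j gamma_0^(j)]. *)
Section optimal_path.
Context {R : realType}.
Variables (I : nat) (beta r : R) (omega : 'I_I.+2 -> R) (F : nat -> R -> R).
Hypothesis beta_gt0 : 0 < beta.
Hypothesis omega_simplex : simplex omega.
Hypothesis r_ge0 : 0 <= r.
Hypothesis dF : forall j (x : R), is_derive x 1 (F j) (- F j.+1 x).
Hypothesis F_top : forall x, F I.+2 x = r * F I.+1 x.
(** In the second alternative component [I+] stays empty along the path. *)
Hypothesis F_top_sign :
  (forall x, 0 < F I.+1 x) \/ (r = 0 /\ forall x, F I.+1 x = 0).
Hypothesis F00 : F 0 0 = 1.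
(** The initial rate of component 0 is 1: the first balls all fall into empty urns. *)
Hypothesis F10 : F 1 0 = 1.
Hypothesis F_end : forall j, (j < I.+1)%N ->
  F j beta = j`!%:R * omega (inord j) / beta ^+ j.

Let P j x := pow_fact j x * F j x.
Let Pp x := 1 - \sum_(j < I.+1) P j x.

Definition system_path (j : 'I_I.+2) (x : R) : R :=
  if (j <= I)%N then pow_fact j x * F j x
  else 1 - \sum_(i < I.+1) pow_fact i x * F i x.

Let g := system_path.

(** * Signs of the system *)

Lemma system_eq0S j : (forall x, F j x = 0) -> forall x, F j.+1 x = 0.
Proof.
move=> Fj0 x; have := dF j x.
rewrite (_ : F j = fun=> 0); last exact/funext.
move=> H; have := @derive_val _ _ _ _ _ _ _ H.
by rewrite (@derive_val _ _ _ _ _ _ _ (is_derive_cst (0 : R) x (1 : R))) => /eqP;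
  rewrite eq_sym oppr_eq0 => /eqP.
Qed.

Lemma system_end_ge0 j : (j < I.+2)%N -> 0 <= F j beta.
Proof.
rewrite ltnS leq_eqVlt => /predU1P[->|jI].
  by case: F_top_sign => [F0|[_ ->]//]; exact: ltW.
rewrite F_end// mulr_ge0 ?invr_ge0 ?exprn_ge0 ?(ltW beta_gt0)// mulr_ge0//.
exact: omega_simplex.1.
Qed.

(** Descending induction from [I.+1]. If [F_(j+1)] is positive before [beta], then [F_j] decreases
    strictly there and so exceeds its nonnegative value at [beta]. If [F_(j+1)] vanishes, then [F_j]
    is constant, equal to that value. *)
Lemma system_sign j : (j < I.+2)%N ->
  (forall x, x < beta -> 0 < F j x) \/ (forall x, F j x = 0).
Proof.
move=> jI; have [k ->] : exists k, j = (I.+1 - k)%N.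
  by exists (I.+1 - j)%N; rewrite subKn.
elim: k => [|k IH].
  by rewrite subn0; case: F_top_sign => [F0|[_ F0]]; [left|right].
(* Once [k] reaches [I.+1], the truncated subtraction stays at 0 and nothing changes. *)
have [kI|kI] := leqP I.+1 k.
  by rewrite (_ : (I.+1 - k.+1 = I.+1 - k)%N)//; lia.
have Sk : (I.+1 - k)%N = (I.+1 - k.+1).+1 by rewrite subnSK.
move: IH; rewrite Sk; set i := (I.+1 - k.+1)%N => IH.
have iI : (i < I.+2)%N by rewrite /i; lia.
have Fi0 := system_end_ge0 iI.
case: IH => F0.
  left => x xb; have [c /andP[_ cb] cE] := is_derive_MVT xb (fun y _ => dF i y).
  have : F i beta - F i x < 0.
    by rewrite cE mulNr oppr_lt0 mulr_gt0 ?subr_gt0// F0.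
  by rewrite subr_lt0; exact: le_lt_trans.
have Fcst x : F i x = F i beta.
  apply: is_derive_0_is_cst => y.
  by have := dF i y; rewrite F0 oppr0.
move: Fi0; rewrite le_eqVlt => /predU1P[F0'|F0'].
  by right => x; rewrite Fcst.
by left => x _; rewrite Fcst.
Qed.

Lemma system_ge0 j x : (j < I.+2)%N -> x <= beta -> 0 <= F j x.
Proof.
move=> jI; rewrite le_eqVlt => /predU1P[->|xb]; first exact: system_end_ge0.
by case: (system_sign jI) => [F0|->//]; exact/ltW/F0.
Qed.

(** * Occupancies and rates of the path *)

Lemma system_pathE j : (j < I.+1)%N -> g (inord j) = P j.
Proof.
move=> jI; apply/funext => x; rewrite /g /system_path inordK; last exact: ltnW.
by rewrite ifT.
Qed.

Lemma system_path_top : g (Iplus I) = Pp.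
Proof. by apply/funext => x; rewrite /g /system_path/= ltnn. Qed.

Lemma psi_system_path j : (j < I.+1)%N ->
  psi g j = fun y => \sum_(k < j.+1) P k y.
Proof.
move=> jI; apply/funext => y; rewrite psiE; last exact: ltnW.
apply: eq_bigr => k _; rewrite system_pathE//.
exact: leq_trans (ltn_ord k) jI.
Qed.

Lemma theta_system_path j x : (j < I.+1)%N ->
  theta g (inord j) x = pow_fact j x * F j.+1 x.
Proof.
move=> jI; rewrite /theta inordK; last exact: ltnW.
rewrite ifT// psi_system_path// derive1E.
by rewrite (@derive_val _ _ _ _ _ _ _ (is_derive_sum_pow_fact j x dF)) opprK.
Qed.

(* Both sides have the same derivative, because [F I.+2 = r * F I.+1]. *)
Lemma system_top_rate x :
  1 - \sum_(j < I.+1) pow_fact j x * F j.+1 x = r * Pp x.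
Proof.
pose D y := (1 - \sum_(j < I.+1) pow_fact j y * F j.+1 y) - r * (1 - \sum_(j < I.+1) P j y).
(* At 0 only the terms with [j = 0] survive, and both sides vanish by [F00] and [F10]. *)
have D0 : D 0 = 0.
  rewrite /D !big_ord_recl/= /P !pow_fact0 !mul1r F00 F10.
  by rewrite !big1 ?addr0 ?subrr ?mulr0 ?subr0// => j _; rewrite pow_factS0 mul0r.
apply/eqP; rewrite -subr_eq0 -/(D x) -D0; apply/eqP/is_derive_0_is_cst => y.
have dS : forall j (z : R), is_derive z 1 (F j.+1) (- F j.+2 z) by move=> j z; exact: dF.
have H1 := is_derive_sub (is_derive_cst (1 : R) y (1 : R)) (is_derive_sum_pow_fact I y dS).
have H2 := is_derive_sub (is_derive_cst (1 : R) y (1 : R)) (is_derive_sum_pow_fact I y dF).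
have := is_derive_sub H1 (is_derive_scale r H2).
by congr is_derive; rewrite F_top; ring.
Qed.

Lemma theta_system_path_top x : theta g (Iplus I) x = r * Pp x.
Proof.
rewrite -system_top_rate /theta/= ltnn; congr (1 - _).
rewrite [RHS](big_ord_widen _ (fun j => pow_fact j x * F j.+1 x) (leqnSn I.+1)).
apply: eq_big => [j|j jI]; first by rewrite ltnS.
rewrite psi_system_path// derive1E.
by rewrite (@derive_val _ _ _ _ _ _ _ (is_derive_sum_pow_fact j x dF)) opprK.
Qed.

Lemma is_derive_system_path_top (x : R) :
  is_derive x 1 Pp (pow_fact I x * F I.+1 x).
Proof.
have := is_derive_sub (is_derive_cst (1 : R) x (1 : R)) (is_derive_sum_pow_fact I x dF).
by rewrite sub0r opprK.
Qed.

Lemma system_path_top0 : Pp 0 = 0.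
Proof.
rewrite /Pp big_ord_recl/= /P pow_fact0 mul1r F00.
by rewrite big1 ?addr0 ?subrr// => j _; rewrite pow_factS0 mul0r.
Qed.

(** The last component starts at 0, so this formula lets it inherit the sign of [F I.+1]. *)
Lemma system_path_top_MVT x : 0 < x -> exists2 c, 0 < c < x &
  Pp x = pow_fact I c * F I.+1 c * x.
Proof.
move=> x0; have [c cx] := is_derive_MVT x0 (fun y _ => is_derive_system_path_top y).
by rewrite system_path_top0 !subr0 => ->; exists c.
Qed.

Lemma system_path_top_ge0 x : 0 <= x <= beta -> 0 <= Pp x.
Proof.
move=> /andP[]; rewrite le_eqVlt => /predU1P[<-|x0] xb.
  by rewrite system_path_top0.
have [c /andP[c0 cx] ->] := system_path_top_MVT x0.
rewrite mulr_ge0 ?(ltW x0)// mulr_ge0 ?pow_fact_ge0 ?(ltW c0)//.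
by rewrite system_ge0// (le_trans (ltW cx)).
Qed.

Lemma system_path_top_gt0 x : (forall y, 0 < F I.+1 y) -> 0 < x -> 0 < Pp x.
Proof.
move=> F0 x0; have [c /andP[c0 cx] ->] := system_path_top_MVT x0.
by rewrite mulr_gt0// mulr_gt0// pow_fact_gt0.
Qed.

(** * Admissibility of the path *)

Lemma sum_ordSr (f : 'I_I.+2 -> R) :
  \sum_(j < I.+2) f j = \sum_(j < I.+1) f (inord j) + f (Iplus I).
Proof.
rewrite big_ord_recr/=; congr (_ + _); apply: eq_bigr => j _; congr f.
have jI : (j < I.+2)%N := ltnW (ltn_ord j).
by apply/val_inj; rewrite /= inordK.
Qed.

Lemma ord_forall_split (Q : 'I_I.+2 -> Prop) :
  (forall j, (j < I.+1)%N -> Q (inord j)) -> Q (Iplus I) -> forall j, Q j.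
Proof.
move=> Qj Qp j; have := ltn_ord j; rewrite ltnS leq_eqVlt => /predU1P[jI|jI].
  by rewrite (_ : j = Iplus I)//; exact/val_inj.
by rewrite -(inord_val j); exact: Qj.
Qed.

Lemma system_path_simplex x : 0 <= x <= beta -> simplex (fun j => g j x).
Proof.
move=> xb; have /andP[x0 xb'] := xb; split.
  apply: ord_forall_split => [j jI|].
    by rewrite system_pathE// mulr_ge0 ?pow_fact_ge0// system_ge0// ltnW.
  by rewrite system_path_top system_path_top_ge0.
rewrite sum_ordSr system_path_top /Pp addrC -[RHS](subrK (\sum_(j < I.+1) P j x)).
by congr (_ + _); apply: eq_bigr => j _; rewrite system_pathE.
Qed.

Lemma theta_system_path_simplex x : 0 <= x <= beta -> simplex (fun j => theta g j x).
Proof.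
move=> xb; have /andP[x0 xb'] := xb; split.
  apply: ord_forall_split => [j jI|].
    by rewrite theta_system_path// mulr_ge0 ?pow_fact_ge0// system_ge0.
  by rewrite theta_system_path_top mulr_ge0 ?system_path_top_ge0.
rewrite sum_ordSr theta_system_path_top -system_top_rate.
rewrite addrC -[RHS](subrK (\sum_(j < I.+1) pow_fact j x * F j.+1 x)).
by congr (_ + _); apply: eq_bigr => j _; rewrite theta_system_path.
Qed.

Lemma system_path_abs_cont j : abs_cont_on 0 beta (g j).
Proof.
have Pac k : abs_cont_on 0 beta (P k).
  apply: (abs_cont_onM (ltW beta_gt0) (pow_fact_abs_cont _ (ltW beta_gt0))).
  apply: (C1_abs_cont_on (ltW beta_gt0) (fun x _ => dF k x)).
  by move=> x _; apply: cvgN; exact: is_derive_continuous (dF _ _).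
move: j; apply: ord_forall_split => [j jI|]; first by rewrite system_pathE.
rewrite system_path_top.
rewrite (_ : Pp = fun x => 1 + -1 * \sum_(j < I.+1) P j x).
  apply: (abs_cont_onD (abs_cont_on_cst _ _ _)).
  apply: (abs_cont_onM (ltW beta_gt0) (abs_cont_on_cst _ _ _)).
  by apply: abs_cont_on_sum => j _; exact: Pac.
by apply/funext => x; rewrite mulN1r.
Qed.

Lemma system_path_end j : g j beta = omega j.
Proof.
have E k : (k < I.+1)%N -> P k beta = omega (inord k).
  move=> kI; rewrite /P F_end// /pow_fact; field.
  by rewrite pnatr_eq0 -lt0n fact_gt0 gt_eqF// exprn_gt0.
move: j; apply: ord_forall_split => [j jI|]; first by rewrite system_pathE// E.
rewrite system_path_top /Pp -omega_simplex.2 sum_ordSr.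
have -> : \sum_(j < I.+1) P j beta = \sum_(j < I.+1) omega (inord j).
  by apply: eq_bigr => k _; rewrite E.
by rewrite addrAC subrr add0r.
Qed.

Lemma system_path_init j : g j 0 = empty_init R j.
Proof.
move: j; apply: ord_forall_split => [j jI|]; last first.
  by rewrite system_path_top system_path_top0 /empty_init.
rewrite system_pathE// /P /empty_init -val_eqE/= inordK; last exact: ltnW.
case: j {jI} => [|j]; first by rewrite pow_fact0 mul1r F00.
by rewrite pow_factS0 mul0r.
Qed.

Lemma system_path_valid : valid beta g.
Proof.
split; first exact: system_path_abs_cont.
split; first exact: system_path_simplex.
by apply: aeW => x; exact: theta_system_path_simplex.
Qed.

Lemma system_path_A_set : A_set (@empty_init R I) omega beta g.
Proof.
by split; [exact: system_path_valid|split; [exact: system_path_init|exact: system_path_end]].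
Qed.

(** * Euler-Lagrange equations *)

Lemma is_derive_ln_system j (x : R) : (j < I.+2)%N -> x < beta ->
  is_derive x 1 (fun y => ln (F j y)) (- (F j.+1 x / F j x)).
Proof.
move=> jI xb; case: (system_sign jI) => F0.
  by rewrite -mulNr; apply: is_derive_ln_comp (dF j x); exact: F0.
(* If [F j] vanishes identically, its logarithm is the constant [ln 0] and the claimed derivative is
   0 because [F j.+1] vanishes too. *)
rewrite (system_eq0S F0) mul0r oppr0.
rewrite (_ : (fun y => _) = (fun=> ln 0)); first exact: is_derive_cst.
by apply/funext => y; rewrite F0.
Qed.

(** The common form of all Euler-Lagrange equations, since [F_(j+1) / F_j] is the ratio
    [theta_j / gamma_j] along the path. It is the difference of two logarithmic derivatives; if
    [F_(j+1)] vanishes identically, both sides are 0. *)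
Lemma is_derive_ln_ratio j (x : R) : (j < I.+1)%N -> x < beta ->
  is_derive x 1 (fun y => - ln (F j.+1 y / F j y))
    (- (F j.+1 x / F j x) + F j.+2 x / F j.+1 x).
Proof.
move=> jI xb; have jI' := ltnW jI.
case: (@system_sign j.+1 jI) => F0; last first.
  rewrite !F0 (system_eq0S F0) !mul0r oppr0 addr0.
  rewrite (_ : (fun y => _) = (fun=> - ln 0)); first exact: is_derive_cst.
  by apply/funext => y; rewrite F0 mul0r.
have F0' y : y < beta -> 0 < F j y.
  case: (system_sign jI') => [|/system_eq0S z]; first exact.
  by move=> /F0; rewrite z ltxx.
have := is_derive_sub (is_derive_ln_system jI' xb) (is_derive_ln_system (j := j.+1) jI xb).
rewrite opprK; apply: near_eq_is_derive; near=> y.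
have yb : y < beta by near: y; exact: lt_nbhsl.
by rewrite ln_div ?posrE ?F0 ?F0'// opprB.
Unshelve. all: by end_near. Qed.

Lemma system_path_rate j y : (j < I.+1)%N -> 0 < y ->
  theta g (inord j) y / g (inord j) y = F j.+1 y / F j y.
Proof.
move=> jI y0; rewrite theta_system_path// system_pathE// /P -mulf_div divff ?mul1r//.
by rewrite gt_eqF// pow_fact_gt0.
Qed.

(** The ratio of rate to occupancy in component [I+] is the constant [r], so its logarithm does not
    affect the derivative. In the last equation the same [r] appears as [F I.+2 / F I.+1]. *)
Lemma system_path_EL_general : (forall x, 0 < F I.+1 x) -> EL_general beta g.
Proof.
move=> F0 x /andP[x0 xb].
have top y : 0 < y -> theta g (Iplus I) y / (1 - psi g I y) = r.
  move=> y0; rewrite theta_system_path_top psi_system_path// -/(Pp y) mulfK//.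
  by rewrite gt_eqF// system_path_top_gt0.
have D i : (i < I.+1)%N ->
    is_derive x 1
       (fun y => - ln (theta g (inord i) y / g (inord i) y)
                 + ln (theta g (Iplus I) y / (1 - psi g I y)))
       (- (F i.+1 x / F i x) + F i.+2 x / F i.+1 x).
  move=> iI.
  have := is_derive_add (is_derive_ln_ratio iI xb) (is_derive_cst (ln r) x (1 : R)).
  rewrite addr0; apply: near_eq_is_derive; near=> y.
  have y0 : 0 < y by near: y; exact: lt_nbhsr.
  by rewrite top// system_path_rate.
split=> [i iI|]; last first.
  rewrite system_path_rate// top//; have := D I (leqnn _).
  by rewrite F_top mulfK// gt_eqF.
rewrite !system_path_rate//; last exact: ltnW.
by apply: D; exact: ltnW.
Unshelve. all: by end_near. Qed.

Lemma psi_sub_psi_prev (f : 'I_I.+2 -> R -> R) i x : (i < I.+2)%N ->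
  psi f i x - psi_prev f i x = f (inord i) x.
Proof.
move=> iI; rewrite psiE// /psi_prev.
rewrite (eq_bigr (fun j : 'I_I.+2 => f (inord j) x)); last by move=> j _; rewrite inord_val.
rewrite -(big_ord_widen _ (fun j => f (inord j) x) (ltnW iI)).
by rewrite big_ord_recr/= addrAC subrr add0r.
Qed.

Lemma psiS_sub (f : 'I_I.+2 -> R -> R) i x : (i < I.+1)%N ->
  psi f i.+1 x - psi f i x = f (inord i.+1) x.
Proof.
move=> iI; rewrite !psiE//; last exact: ltnW.
by rewrite big_ord_recr/= addrAC subrr add0r.
Qed.

Lemma system_path_EL_reduced m : r = 0 -> (m <= I.+1)%N -> EL_reduced beta g m.
Proof.
move=> rE mI x /andP[x0 xb] i im; have iI := leq_trans im mI.
have iI2 : (i < I.+2)%N := ltnW iI.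
rewrite psi_sub_psi_prev// psiS_sub// system_path_rate//.
(* For [i = I] the next component is [I+], whose rate is 0 because [r = 0]; [F I.+2] is 0 for the
   same reason. *)
have -> : theta g (inord i.+1) x / g (inord i.+1) x = F i.+2 x / F i.+1 x.
  move: iI; rewrite leq_eqVlt => /predU1P[[->]|iI]; last exact: system_path_rate.
  rewrite (_ : inord I.+1 = Iplus I); last by apply/val_inj; rewrite /= inordK.
  by rewrite theta_system_path_top F_top rE !mul0r.
apply: near_eq_is_derive (is_derive_ln_ratio iI xb); near=> y.
have y0 : 0 < y by near: y; exact: lt_nbhsr.
by rewrite psi_sub_psi_prev// system_path_rate.
Unshelve. all: by end_near. Qed.

(** * Cost of the path *)

Let G j := g (inord j).
Let U j y := ln (F j y).
(** The potential of the dual bound with [rho = r]. Along the path its derivative before [beta] is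
    [D], the relative entropy itself, so the dual bound is attained. *)
Let Psi y := 1 * y + \sum_(j < I.+2) G j y * U j y +
  ln r * (y - \sum_(j < I.+2) j%:R * G j y).
Let D x := \sum_(j < I.+1) pow_fact j x * F j.+1 x * (U j.+1 x - U j x) +
  r * Pp x * ln r.

Let G_top : G I.+1 = Pp.
Proof.
rewrite -system_path_top /G; congr g.
by apply/val_inj; rewrite /= inordK.
Qed.

Let ratioM j x : (j < I.+2)%N -> x < beta -> F j.+1 x / F j x * F j x = F j.+1 x.
Proof.
move=> jI xb; case: (system_sign jI) => F0; first by rewrite divfK// gt_eqF// F0.
by rewrite (system_eq0S F0) !mul0r.
Qed.

Let is_derive_Psi (x : R) : x < beta -> is_derive x 1 Psi (D x).
Proof.
move=> xb.
pose a j := pow_fact j x * F j.+1 x.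
(* The derivative of [G j], inflow minus outflow: no inflow for [j = 0], no outflow for
   [j = I.+1]. *)
pose c j := (if j is k.+1 then a k else 0) - (if (j < I.+1)%N then a j else 0).
have dG j : (j < I.+2)%N -> is_derive x 1 (G j) (c j).
  rewrite ltnS leq_eqVlt => /predU1P[->|jI].
    by rewrite G_top /c ltnn subr0; exact: is_derive_system_path_top.
  rewrite /G system_pathE// /c jI; case: j jI => [|j] jI.
    rewrite (_ : P 0 = F 0%N); first by rewrite /a pow_fact0 mul1r sub0r.
    by apply/funext => y; rewrite /P pow_fact0 mul1r.
  have := is_derive_mul (is_derive_pow_factS j x) (dF j.+1 x).
  by congr is_derive; rewrite /a; ring.
have cS j : (j < I.+1)%N -> \sum_(k < j.+1) c k = - a j.
  elim: j => [|j IH] jI; first by rewrite big_ord_recr big_ord0/= /c/= !add0r.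
  rewrite big_ord_recr/= IH; last exact: ltnW.
  by rewrite /c jI; ring.
have c0 : \sum_(k < I.+2) c k = 0.
  by rewrite big_ord_recr/= cS// /c ltnn subr0 addNr.
have := potential_derive 1 (ln r) dG (fun j jI => is_derive_ln_system jI xb) c0.
rewrite /=.
have -> : \sum_(j < I.+1) - (\sum_(i < j.+1) c i) = \sum_(j < I.+1) a j.
  by apply: eq_bigr => j _; rewrite cS// opprK.
have -> : \sum_(j < I.+1) - (\sum_(i < j.+1) c i) * (ln (F j.+1 x) - ln (F j x)) =
    \sum_(j < I.+1) a j * (U j.+1 x - U j x).
  by apply: eq_bigr => j _; rewrite cS// opprK.
(* This is the sum of all the rates, hence 1, and it cancels the drift [1 * y] of [Psi]. *)
have -> : \sum_(j < I.+2) F j.+1 x / F j x * G j x = 1.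
  rewrite big_ord_recr/= G_top.
  have -> : F I.+2 x / F I.+1 x * Pp x = r * Pp x.
    case: F_top_sign => [F0|[-> F0]].
      by rewrite F_top mulfK// gt_eqF.
    by rewrite (system_eq0S F0) !mul0r.
  rewrite -system_top_rate.
  have -> : \sum_(i < I.+1) F i.+1 x / F i x * G i x =
      \sum_(i < I.+1) pow_fact i x * F i.+1 x.
    apply: eq_bigr => i _; rewrite /G system_pathE// /P mulrCA ratioM//.
    exact: ltnW (ltn_ord i).
  by rewrite addrC subrK.
rewrite /a system_top_rate /D => H.
by apply: is_derive_eq H _; ring.
Qed.

Let rel_ent_D x : 0 <= x -> x < beta ->
  rel_ent (fun j => theta g j x) (fun j => g j x) = (D x)%:E.
Proof.
move=> x0 xb; have xb' : 0 <= x <= beta by rewrite x0 ltW.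
rewrite /rel_ent big_ord_recr/= /D EFinD -sumEFin; congr (_ + _)%E.
  apply: eq_bigr => j _; have jI2 : (j < I.+2)%N := ltnW (ltn_ord j).
  have -> : widen_ord (leqnSn I.+1) j = inord j by apply/val_inj; rewrite /= inordK.
  rewrite theta_system_path// system_pathE// /P /ent_term.
  have F1 : 0 <= F j.+1 x by exact: (@system_ge0 j.+1 x (ltn_ord j) (ltW xb)).
  (* A term with zero rate vanishes on both sides: by the convention in [ent_term], and by its
     factor in [D]. *)
  case: (leP (pow_fact j x * F j.+1 x) 0) => [w0|w0].
    have -> : pow_fact j x * F j.+1 x = 0.
      by apply/eqP; rewrite eq_le w0 mulr_ge0// pow_fact_ge0.
    by rewrite mul0r.
  have p0 : 0 < pow_fact j x.
    rewrite lt_neqAle pow_fact_ge0// andbT eq_sym.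
    by apply: contraTneq w0 => ->; rewrite mul0r ltxx.
  have F1' : 0 < F j.+1 x by rewrite pmulr_rgt0 in w0.
  have F0 : 0 < F j x.
    case: (system_sign jI2) => [|/system_eq0S z]; first exact.
    by move: F1'; rewrite z ltxx.
  rewrite leNgt mulr_gt0//= -mulf_div divff ?mul1r ?gt_eqF//.
  by rewrite /U ln_div// posrE.
rewrite -/(Iplus I) theta_system_path_top system_path_top /ent_term.
have P0 := system_path_top_ge0 xb'.
case: (leP (r * Pp x) 0) => [rP|rP].
  have -> : r * Pp x = 0 by apply/eqP; rewrite eq_le rP mulr_ge0.
  by rewrite mul0r.
have Pp0 : 0 < Pp x.
  rewrite lt_neqAle P0 andbT eq_sym.
  by apply: contraTneq rP => ->; rewrite mulr0 ltxx.
by rewrite leNgt Pp0/= mulfK// gt_eqF.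
Qed.

Let D_ge0 x : 0 <= x -> x < beta -> 0 <= D x.
Proof.
move=> x0 xb; have xb' : 0 <= x <= beta by rewrite x0 ltW.
rewrite -lee_fin -rel_ent_D//; apply: rel_ent_ge0.
  exact: theta_system_path_simplex.
exact: system_path_simplex.
Qed.

Let continuous_pow_fact j : continuous (@pow_fact R j).
Proof.
move=> x; case: j => [|j]; last exact: is_derive_continuous (is_derive_pow_factS j x).
rewrite (_ : pow_fact 0 = fun=> 1); first exact: cvg_cst.
by apply/funext => y; rewrite pow_fact0.
Qed.

Let continuous_D x : x < beta -> {for x, continuous D}.
Proof.
move=> xb; apply: cvgD.
  apply: (continuous_bigsum (f := fun j y => pow_fact j y * F j.+1 y * (U j.+1 y - U j y))).
  move=> j jI; apply: cvgM.
    apply: cvgM; first exact: continuous_pow_fact.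
    exact: is_derive_continuous (dF _ _).
  apply: cvgB; first exact: is_derive_continuous (@is_derive_ln_system j.+1 x jI xb).
  exact: is_derive_continuous (@is_derive_ln_system j x (ltnW jI) xb).
apply: cvgM; last exact: cvg_cst.
apply: cvgM; first exact: cvg_cst.
exact: is_derive_continuous (is_derive_system_path_top x).
Qed.

Let Psi0 : Psi 0 = 0.
Proof.
rewrite /Psi mulr0 add0r sub0r.
have z j : (j < I.+1)%N -> G j.+1 0 = 0.
  rewrite ltnS leq_eqVlt => /predU1P[->|jI]; first by rewrite G_top system_path_top0.
  by rewrite /G system_pathE// /P pow_factS0 mul0r.
rewrite !big1 ?oppr0 ?mulr0 ?addr0// => -[[|j] jI] _ /=.
- by rewrite mul0r.
- by rewrite z// mulr0.
- by rewrite /U F00 ln1 mulr0.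
- by rewrite z// mul0r.
Qed.

Let Psi_end : Psi beta = beta + \sum_(j < I.+2) omega (inord j) * ln (F j beta) +
  (beta - mean_balls omega) * ln r.
Proof.
rewrite /Psi mul1r mulrC mean_ballsE /G.
by congr (_ + _ + (_ - _) * _); apply: eq_bigr => j _; rewrite system_path_end.
Qed.

(* Terms with [F j beta = 0] are nonpositive near [beta], so dropping them
   bounds [Psi] by a function continuous at [beta]. *)
Let Psi_le_end b : 0 <= b -> b < beta -> Psi b <= Psi beta.
Proof.
move=> b0 bb'.
pose T j y := if 0 < F j beta then G j y * U j y else 0.
pose Psit y := 1 * y + \sum_(j < I.+2) T j y + ln r * (y - \sum_(j < I.+2) j%:R * G j y).
have cG j : (j < I.+2)%N -> {for beta, continuous (G j)}.
  rewrite ltnS leq_eqVlt => /predU1P[->|jI].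
    by rewrite G_top; exact: is_derive_continuous (is_derive_system_path_top _).
  rewrite /G system_pathE//; apply: cvgM; first exact: continuous_pow_fact.
  exact: is_derive_continuous (dF _ _).
have cPsit : {for beta, continuous Psit}.
  apply: cvgD; first apply: cvgD.
  - by apply: cvgM; [exact: cvg_cst|exact: cvg_id].
  - apply: (continuous_bigsum (f := T)) => j jI; have [F0|F0] := boolP (0 < F j beta).
      rewrite (_ : T j = fun y => G j y * U j y); last by apply/funext => y; rewrite /T F0.
      apply: cvgM; first exact: cG.
      exact: is_derive_continuous (is_derive_ln_comp F0 (dF _ _)).
    rewrite (_ : T j = fun=> 0); first exact: cst_continuous.
    by apply/funext => y; rewrite /T (negbTE F0).
  - apply: cvgM; first exact: cvg_cst.
    apply: cvgB; first exact: cvg_id.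
    apply: (continuous_bigsum (f := fun j y => j%:R * G j y)) => j jI.
    by apply: cvgM; [exact: cvg_cst|exact: cG].
(* At [beta] the dropped terms are 0 by the convention [ln 0 = 0]. *)
have Psite : Psit beta = Psi beta.
  rewrite /Psit /Psi; congr (_ + _ + _); apply: eq_bigr => j _.
  rewrite /T; case: ifPn => //; rewrite -leNgt => F0.
  by rewrite /U ln0// mulr0.
rewrite -Psite.
have cl : Psit y @[y --> beta^'-] --> Psit beta by exact: cvg_at_left_filter.
apply: (cvgr_to_ge cl).
(* Where [F j beta = 0], continuity gives [F j < 1] near [beta], so the dropped terms contain a
   nonpositive logarithm. *)
have small (j : 'I_I.+2) : \forall y \near beta^'-, F j beta = 0 -> F j y < 1.
  case: (eqVneq (F j beta) 0) => [F0|F0]; last by apply: nearW => y /eqP; rewrite (negbTE F0).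
  have cF : F j y @[y --> beta^'-] --> 0.
    by rewrite -F0; apply: cvg_at_left_filter; exact: is_derive_continuous (dF _ _).
  by apply: filterS (cvgr_lt _ cF _ ltr01) => y Fy _.
have {}small : \forall y \near beta^'-, forall j : 'I_I.+2, F j beta = 0 -> F j y < 1.
  exact: filter_forall.
near=> y.
have yb : y < beta by near: y; exact: nbhs_left_lt.
have by' : b < y by near: y; exact: nbhs_left_gt.
have y0 : 0 <= y by rewrite (le_trans b0)// ltW.
(* [Psi] is nondecreasing before [beta] because its derivative [D] is nonnegative; after that
   [Psi y <= Psit y] remains. *)
apply: (@le_trans _ _ (Psi y)).
  have H x : b <= x <= y -> is_derive x 1 Psi (D x).
    by move=> /andP[_ xy]; apply: is_derive_Psi; exact: le_lt_trans yb.
  have [c /andP[bc cy] cE] := is_derive_MVT by' H.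
  rewrite -subr_ge0 cE mulr_ge0 ?subr_ge0 ?(ltW by')// D_ge0//.
    by rewrite (le_trans b0)// ltW.
  exact: lt_trans yb.
have sm : forall j : 'I_I.+2, F j beta = 0 -> F j y < 1 by near: y.
rewrite /Psi /Psit lerD2r lerD2l; apply: ler_sum => j _.
rewrite /T; case: ifPn => // F0; rewrite mulr_ge0_le0//.
  have yb2 : 0 <= y <= beta by rewrite y0 ltW.
  exact: (system_path_simplex yb2).1.
apply: ln_le0; apply/ltW/sm/eqP; rewrite eq_le leNgt F0/=.
exact: system_end_ge0.
Unshelve. all: by end_near. Qed.

(** The integration stops before [beta], where some [U j] may be discontinuous. *)
Let integral_rel_ent b : 0 < b -> b < beta ->
  (\int[@lebesgue_measure R]_(x in `[0%R, b])
     rel_ent (fun j => theta g j x) (fun j => g j x) = (Psi b)%:E)%E.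
Proof.
move=> b0 bb'.
transitivity (\int[@lebesgue_measure R]_(x in `[0%R, b]) (D x)%:E)%E.
  apply: eq_integral => x; rewrite inE/= in_itv/= => /andP[x0 xb].
  by rewrite rel_ent_D//; exact: le_lt_trans bb'.
rewrite (@continuous_FTC2 _ D Psi)//.
- by rewrite Psi0 sube0.
- apply/continuous_in_subspaceT => x; rewrite inE/= in_itv/= => /andP[_ xb].
  by apply: continuous_D; exact: le_lt_trans bb'.
- split.
  + move=> x; rewrite in_itv/= => /andP[_ xb].
    by case: (is_derive_Psi (lt_trans xb bb')).
  + exact: cvg_at_right_filter (is_derive_continuous (is_derive_Psi beta_gt0)).
  + exact: cvg_at_left_filter (is_derive_continuous (is_derive_Psi bb')).
- move=> x; rewrite in_itv/= => /andP[_ xb]; rewrite derive1E.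
  exact: (@derive_val _ _ _ _ _ _ _ (is_derive_Psi (lt_trans xb bb'))).
Qed.

(** Monotone convergence along intervals exhausting [[0, beta[]; each partial integral is a value of
    [Psi], bounded by [Psi_le_end]. *)
Lemma J_system_path_le : (J beta g <=
  (beta + \sum_(j < I.+2) omega (inord j) * ln (F j beta) +
    (beta - mean_balls omega) * ln r)%:E)%E.
Proof.
rewrite -Psi_end /J asboolT; last exact: system_path_valid.
set f := (fun x => rel_ent _ _).
have f0 x : 0 <= x <= beta -> (0 <= f x)%E.
  move=> xb; apply: rel_ent_ge0; first exact: theta_system_path_simplex.
  exact: system_path_simplex.
have mf : measurable_fun (`[0, beta[%classic : set (measurableTypeR R)) f.
  apply: (eq_measurable_fun (EFin \o D)).
    by move=> x; rewrite inE/= in_itv/= => /andP[x0 xb]; rewrite /f rel_ent_D.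
  apply/measurable_EFinP; apply: subspace_continuous_measurable_fun.
    exact: measurable_itv.
  apply/continuous_in_subspaceT => x; rewrite inE/= in_itv/= => /andP[_ xb].
  exact: continuous_D.
rewrite -(integral_itv_bndo_bndc mf) itv_bnd_open_bigcup.
pose B n : set (measurableTypeR R) := `[0, beta - n.+1%:R^-1]%classic.
have Blt n : beta - n.+1%:R^-1 < beta by rewrite ltrBlDr ltrDl invr_gt0.
have mB n : measurable (B n) by exact: measurable_itv.
have BS n c : beta - n.+1%:R^-1 <= c -> B n `<=` `[0, c]%classic.
  by move=> nc x; rewrite /B/= !in_itv/= => /andP[-> xn]/=; exact: le_trans nc.
have ndB : {homo B : n m / (n <= m)%N >-> (n <= m)%O}.
  move=> n m nm; apply/subsetPset; apply: BS.
  by rewrite lerB// lef_pV2 ?posrE// ler_nat.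
have mfB n : measurable_fun (B n) f.
  apply: measurable_funS mf; first exact: measurable_itv.
  move=> x; rewrite /B/= !in_itv/= => /andP[-> xn]/=; exact: le_lt_trans (Blt n).
have fB n x : B n x -> (0 <= f x)%E.
  rewrite /B/= in_itv/= => /andP[x0 xn]; apply: f0.
  by rewrite x0 (le_trans xn (ltW (Blt n))).
apply: (cvge_to_le (ge0_nondecreasing_set_cvg_integral ndB mB mfB fB)).
apply: nearW => n.
(* The maximum with [beta / 2] keeps the right end positive when [n] is small. *)
pose c := Num.max (beta - n.+1%:R^-1) (beta / 2).
have c0 : 0 < c by rewrite lt_max divr_gt0 ?orbT.
have cb : c < beta by rewrite gt_max Blt/= ltr_pdivrMr// ltr_pMr// ltr1n.
apply: (@le_trans _ _ (\int[@lebesgue_measure R]_(x in `[0%R, c]) f x)%E).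
  apply: (ge0_subset_integral _ (mB n) (measurable_itv `[0, c])).
  - apply: measurable_funS mf; first exact: measurable_itv.
    move=> x; rewrite /= !in_itv/= => /andP[-> xn]/=; exact: le_lt_trans cb.
  - move=> x; rewrite /= in_itv/= => /andP[x0 xc]; apply: f0.
    by rewrite x0 (le_trans xc (ltW cb)).
  - by apply: BS; rewrite le_max lexx.
rewrite integral_rel_ent// lee_fin; apply: Psi_le_end => //.
exact: ltW.
Qed.

(** * Minimality of the path *)

Lemma system_end_pos j : (j < I.+2)%N -> omega (inord j) = 0 \/ 0 < F j beta.
Proof.
rewrite ltnS leq_eqVlt => /predU1P[->|jI].
  case: F_top_sign => [F0|[_ F0]]; [by right|left].
  rewrite -system_path_end -/(G _) G_top.
  by have [c _ ->] := system_path_top_MVT beta_gt0; rewrite F0 mulr0 mul0r.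
have := omega_simplex.1 (inord j); rewrite le_eqVlt => /predU1P[<-|w0]; first by left.
right; rewrite F_end// divr_gt0 ?exprn_gt0// mulr_gt0//.
Qed.

(** The signed derivatives of [(beta + 1 - x)^(I+1)], which has no zero up to [beta], serve for
    [r = 0]; those of [exp (- r x)] serve for [r > 0]. *)
Lemma positive_system : exists H : nat -> R -> R,
  [/\ forall j (x : R), is_derive x 1 (H j) (- H j.+1 x),
      forall x, H I.+2 x = r * H I.+1 x &
      forall j (x : R), (j < I.+2)%N -> 0 <= x <= beta -> 0 < H j x].
Proof.
move: r_ge0; rewrite le_eqVlt => /predU1P[<-|r0].
  exists (fun j x => (I.+1 ^_ j)%:R * (beta + 1 - x) ^+ (I.+1 - j)); split.
  - move=> j x.
    have H : is_derive x 1 (fun y : R => beta + 1 - y) (-1).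
      by have := is_derive_sub (is_derive_cst (beta + 1) x (1 : R)) (is_derive_id x (1 : R)); rewrite sub0r.
    have := is_derive_scale (I.+1 ^_ j)%:R (is_derive_pow (I.+1 - j) H).
    by congr is_derive; rewrite ffactnSr natrM subnS; ring.
  - by move=> x; rewrite ffact_small// !mul0r.
  - move=> j x jI /andP[_ xb]; rewrite mulr_gt0// ?ltr0n ?ffact_gt0//.
    by rewrite exprn_gt0//; lra.
exists (fun j x => r ^+ j * expR (- (r * x))); split.
- move=> j x.
  have H : is_derive x 1 (fun y : R => - (r * y)) (- r).
    have -> : (fun y : R => - (r * y)) = (fun y => - r * y) by apply/funext => y; rewrite mulNr.
    by have := is_derive_scale (- r) (is_derive_id x (1 : R)); rewrite mulr1.
  have := is_derive_scale (r ^+ j) (is_derive1_comp (is_derive_expR _) H).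
  by congr is_derive; rewrite exprSr; ring.
- by move=> x; rewrite exprS mulrA.
- by move=> j x _ _; rewrite mulr_gt0 ?exprn_gt0 ?expR_gt0.
Qed.

(** The upper bound for the path and the lower bound for a competitor are the same expression in the
    endpoint data. *)
Lemma system_path_minimal f : 0 < r \/ mean_balls omega = beta ->
  A_set (@empty_init R I) omega beta f -> (J beta g <= J beta f)%E.
Proof.
move=> rmean fA; have [H [dH HI H0]] := positive_system.
apply: le_trans J_system_path_le _.
apply: (dual_bound_limit beta_gt0 r_ge0 dF F_top _ dH HI H0) => //.
  by move=> j x jI /andP[_ xb]; exact: system_ge0.
exact: system_end_pos.
Qed.

End optimal_path.

(** * The twisted system *)

Section twisted_system.
Context {R : realType}.
Implicit Types (C rho beta : R) (a : nat -> R).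

(* [(-1)^j] times the [j]-th derivative of
   [C e^(- rho x) + sum_(k < n) a_k (1 - x / beta)^k]. *)
Definition twisted n C rho beta a (j : nat) (x : R) : R :=
  C * rho ^+ j * expR (- (rho * x)) +
  \sum_(k < n) a k * (k ^_ j)%:R / beta ^+ j * (1 - x / beta) ^+ (k - j).

Lemma is_derive_twisted n C rho beta a j (x : R) : beta != 0 ->
  is_derive x 1 (twisted n C rho beta a j) (- twisted n C rho beta a j.+1 x).
Proof.
move=> b0; rewrite /twisted opprD -sumrN.
apply: is_derive_add.
  have H : is_derive x 1 (fun y : R => - (rho * y)) (- rho).
    have -> : (fun y : R => - (rho * y)) = (fun y => - rho * y) by apply/funext => y; rewrite mulNr.
    by have := is_derive_scale (- rho) (is_derive_id x (1 : R)); rewrite mulr1.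
  have := is_derive_scale (C * rho ^+ j) (is_derive1_comp (is_derive_expR _) H).
  by congr is_derive; rewrite exprSr; ring.
apply: (is_derive_bigsum (f := fun k y => a k * (k ^_ j)%:R / beta ^+ j * (1 - y / beta) ^+ (k - j))
  (df := fun k => - (a k * (k ^_ j.+1)%:R / beta ^+ j.+1 * (1 - x / beta) ^+ (k - j.+1)))) => k _.
have H : is_derive x 1 (fun y : R => 1 - y / beta) (- beta^-1).
  have -> : (fun y : R => 1 - y / beta) = (fun y => 1 - beta^-1 * y).
    by apply/funext => y; rewrite mulrC.
  have := is_derive_sub (is_derive_cst (1 : R) x (1 : R)) (is_derive_scale beta^-1 (is_derive_id x (1 : R))).
  by rewrite mulr1 sub0r.
have := is_derive_scale (a k * (k ^_ j)%:R / beta ^+ j) (is_derive_pow (k - j) H).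
congr is_derive; rewrite ffactnSr natrM subnS exprSr; field.
by rewrite b0 expf_neq0.
Qed.

(** Only [k = j] survives at [beta]: the falling factorial kills smaller [k], and a positive power
    of 0 kills larger [k]. *)
Lemma twisted_end n C rho beta a j : beta != 0 -> (j < n)%N ->
  twisted n C rho beta a j beta =
  C * rho ^+ j * expR (- (rho * beta)) + a j * j`!%:R / beta ^+ j.
Proof.
move=> b0 jn; rewrite /twisted divff// subrr; congr (_ + _).
rewrite (bigD1 (Ordinal jn))//= subnn expr0 mulr1 ffactnn big1 ?addr0// => k kj.
have [kltj|jk] := ltnP k j; first by rewrite ffact_small// mulr0 !mul0r.
rewrite expr0n subn_eq0 leqNgt ltn_neqAle jk andbT.
by rewrite eq_sym -val_eqE/= in kj; rewrite kj mulr0.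
Qed.

Lemma twisted_large n C rho beta a j x : (n <= j)%N ->
  twisted n C rho beta a j x = C * rho ^+ j * expR (- (rho * x)).
Proof.
move=> nj; rewrite /twisted big1 ?addr0// => k _.
by rewrite ffact_small ?mulr0 ?mul0r// (leq_trans (ltn_ord k)).
Qed.

Lemma twisted_top n C rho beta a x :
  twisted n.+1 C rho beta a n x =
  C * rho ^+ n * expR (- (rho * x)) + a n * n`!%:R / beta ^+ n.
Proof.
rewrite /twisted big_ord_recr/= big1 ?add0r; last first.
  by move=> k _; rewrite ffact_small ?mulr0 ?mul0r.
by rewrite ffactnn subnn expr0 mulr1.
Qed.

Lemma twisted00 n C rho beta a :
  twisted n C rho beta a 0 0 = C + \sum_(k < n) a k.
Proof.
rewrite /twisted expr0 mulr0 oppr0 expR0 !mulr1; congr (_ + _).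
by apply: eq_bigr => k _; rewrite ffactn0 expr0 divr1 mulr1 mul0r subr0 expr1n mulr1.
Qed.

Lemma twisted10 n C rho beta a :
  twisted n C rho beta a 1 0 = C * rho + (\sum_(k < n) k%:R * a k) / beta.
Proof.
rewrite /twisted expr1 mulr0 oppr0 expR0 mulr1; congr (_ + _).
rewrite mulr_suml; apply: eq_bigr => k _.
by rewrite ffactn1 expr1 mul0r subr0 expr1n mulr1 mulrC [a k * _]mulrC mulrC.
Qed.

Lemma derive1n_twisted n C rho beta a j : beta != 0 ->
  derive1n j (twisted n C rho beta a 0) =
  fun x => (-1) ^+ j * twisted n C rho beta a j x.
Proof.
move=> b0; elim: j => [|j IH].
  by apply/funext => x; rewrite derive1n0 expr0 mul1r.
rewrite derive1nS IH; apply/funext => x; rewrite derive1E.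
rewrite (@derive_val _ _ _ _ _ _ _ (is_derive_scale _ (is_derive_twisted n C rho a j x b0))).
by rewrite exprSr mulrN mulrN1 mulNr.
Qed.

Lemma poisPE i (t : R) : poisP i t = pow_fact i t * expR (- t).
Proof. by rewrite /poisP /pow_fact; ring. Qed.

(** The partial Poisson sum is 1 at 0, and by the telescoping derivative, with every [E j] equal to
    [exp (- x)], it has a negative derivative on positive arguments. *)
Lemma sum_poisP_lt1 n (t : R) : 0 < t -> \sum_(i < n) poisP i t < 1.
Proof.
move=> t0; case: n => [|n]; first by rewrite big_ord0.
have dE (j : nat) (y : R) : is_derive y 1 (fun x => expR (- x)) (- expR (- y)).
  have H : is_derive y 1 (fun y : R => - y) (-1) by have := is_deriveN (is_derive_id y (1 : R)).
  by have := is_derive1_comp (is_derive_expR _) H; rewrite mulrN1.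
have [c /andP[c0 _]] := is_derive_MVT t0
  (fun y _ => @is_derive_sum_pow_fact R (fun=> fun x => expR (- x)) n y dE).
rewrite subr0 big_ord_recl/= [X in _ - X](_ : _ = 1); last first.
  rewrite big_ord_recl/= pow_fact0 oppr0 expR0 mul1r big1 ?addr0// => i _.
  by rewrite pow_factS0 mul0r.
move=> H; have -> : \sum_(i < n.+1) poisP i t = 1 - pow_fact n c * expR (- c) * t.
  rewrite big_ord_recl/= !poisPE; under eq_bigr do rewrite poisPE.
  by move: H => /eqP; rewrite subr_eq => /eqP ->; rewrite mulNr addrC.
by rewrite ltrBlDr ltrDl; exact: mulr_gt0 (mulr_gt0 (pow_fact_gt0 n c0) (expR_gt0 _)) t0.
Qed.

(** Termwise, [i P_i(t) = t P_(i-1)(t)]. *)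
Lemma sum_nat_poisP n (t : R) :
  \sum_(i < n.+1) i%:R * poisP i t = t * \sum_(i < n) poisP i t.
Proof.
rewrite big_ord_recl/= mul0r add0r mulr_sumr; apply: eq_bigr => i _.
rewrite /bump/= add1n /poisP factS natrM exprS; field.
by rewrite pnatr_eq0 -lt0n fact_gt0 nat1r pnatr_eq0.
Qed.

End twisted_system.

(** * The optimal path as the path of a twisted system *)

Section twist.
Context {R : realType}.
Variables (I : nat) (beta rho C : R) (omega : 'I_I.+2 -> R).
Hypothesis beta_gt0 : 0 < beta.
Hypothesis omega_simplex : simplex omega.

(** The index [I.+1] carries the extra term of the boundary case, so that both cases of [twist]
    share one family of [I.+2] coefficients. *)
Definition opt_coef (k : nat) : R :=
  if k == I.+1 then (if mean_balls omega == beta then omega (Iplus I) else 0)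
  else omega (inord k) - C * poisP k (rho * beta).

Definition opt_system := twisted I.+2 C rho beta opt_coef.

Lemma opt_coef_le k : (k < I.+1)%N ->
  opt_coef k = omega (inord k) - C * poisP k (rho * beta).
Proof. by move=> kI; rewrite /opt_coef ltn_eqF. Qed.

Lemma opt_coef_top :
  opt_coef I.+1 = if mean_balls omega == beta then omega (Iplus I) else 0.
Proof. by rewrite /opt_coef eqxx. Qed.

Lemma opt_pathE : opt_path beta omega rho C = system_path opt_system.
Proof.
have b0 : beta != 0 by rewrite gt_eqF.
have g0 : opt_gamma0 beta omega rho C = opt_system 0.
  apply/funext => x; rewrite /opt_gamma0 /opt_system /twisted expr0 mulr1 -addrA.
  congr (_ + _); rewrite big_mkord [RHS]big_ord_recr/=; congr (_ + _).
    apply: eq_bigr => k _; rewrite opt_coef_le//.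
    by rewrite ffactn0 divr1 mulr1 subn0.
  rewrite opt_coef_top ffactn0 divr1 mulr1 subn0.
  by case: ifP => // _; rewrite mul0r.
have gn j x : opt_gamma_nat beta omega rho C j x = pow_fact j x * opt_system j x.
  rewrite /opt_gamma_nat g0 derive1n_twisted// -mulrA; congr (_ * _).
  by rewrite mulrA -exprMn mulN1r opprK expr1n mul1r.
apply/funext => j; apply/funext => x; rewrite /opt_path /system_path gn big_mkord.
by case: ifP => // _; congr (1 - _); apply: eq_bigr => i _.
Qed.

Lemma opt_system_derive j (x : R) : is_derive x 1 (opt_system j) (- opt_system j.+1 x).
Proof. by apply: is_derive_twisted; rewrite gt_eqF. Qed.

(** The Poisson part of the coefficient cancels the exponential at [beta], leaving only [omega]. *)
Lemma opt_system_end j : (j < I.+1)%N ->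
  opt_system j beta = j`!%:R * omega (inord j) / beta ^+ j.
Proof.
move=> jI; rewrite /opt_system twisted_end ?gt_eqF//; last exact: ltnW.
rewrite opt_coef_le// /poisP exprMn; field.
by rewrite pnatr_eq0 -lt0n fact_gt0 expf_neq0// gt_eqF.
Qed.

Lemma sum_omega : \sum_(i < I.+1) omega (inord i) = 1 - omega (Iplus I).
Proof. by rewrite -omega_simplex.2 (sum_ordSr omega) addrK. Qed.

Lemma sum_opt_coef : \sum_(k < I.+2) opt_coef k =
  1 - omega (Iplus I) - C * \sum_(i < I.+1) poisP i (rho * beta) + opt_coef I.+1.
Proof.
rewrite big_ord_recr/= -sum_omega mulr_sumr -sumrB; congr (_ + _).
by apply: eq_bigr => k _; rewrite opt_coef_le.
Qed.

Lemma sum_nat_opt_coef : \sum_(k < I.+2) k%:R * opt_coef k =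
  \sum_(i < I.+1) i%:R * omega (inord i) -
  C * \sum_(i < I.+1) i%:R * poisP i (rho * beta) + I.+1%:R * opt_coef I.+1.
Proof.
rewrite big_ord_recr/= mulr_sumr -sumrB; congr (_ + _).
by apply: eq_bigr => k _; rewrite opt_coef_le// mulrBr mulrCA.
Qed.

(* In terms of the abstract system, the two cases of [twist] are [r = 0]
   (balls just suffice) and [r = rho]. *)
Lemma twist_system : twist beta omega rho C -> exists r : R,
  [/\ 0 <= r, forall x, opt_system I.+2 x = r * opt_system I.+1 x,
      opt_system 0 0 = 1 & opt_system 1 0 = 1] /\
  ((C = 0 /\ r = 0) \/ (C != 0 /\ forall x, 0 < opt_system I.+1 x)) /\
  (0 < r \/ mean_balls omega = beta) /\
  ((forall x, 0 < opt_system I.+1 x) \/ (r = 0 /\ forall x, opt_system I.+1 x = 0)).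
Proof.
move=> [[mean [C0 rho1]]|[mean [rho0]]].
  (* With [C = 0] the system is polynomial of degree at most [I.+1], so its top derivative is
     constant. *)
  have topE x : opt_system I.+1 x = omega (Iplus I) * I.+1`!%:R / beta ^+ I.+1.
    by rewrite /opt_system twisted_top opt_coef_top mean eqxx C0 !mul0r add0r.
  exists 0; split; first split => //.
  - by move=> x; rewrite /opt_system twisted_large// C0 !mul0r.
  - rewrite /opt_system twisted00 sum_opt_coef opt_coef_top mean eqxx C0; ring.
  - rewrite /opt_system twisted10 sum_nat_opt_coef opt_coef_top mean eqxx C0 !mul0r add0r subr0.
    (* This is where the balance of balls enters: the mean equals [beta], so the initial rate is
       [beta / beta]. *)
    have -> : \sum_(i < I.+1) i%:R * omega (inord i) + I.+1%:R * omega (Iplus I) = beta.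
      by rewrite -[RHS]mean /mean_balls big_mkord.
    by rewrite divff// gt_eqF.
  split; first by left.
  split; first by right.
  have := omega_simplex.1 (Iplus I); rewrite le_eqVlt => /predU1P[w0|w0].
    by right; split => // x; rewrite topE -w0 !mul0r.
  left => x; rewrite topE divr_gt0 ?exprn_gt0// mulr_gt0//.
have t0 : 0 < rho * beta by rewrite mulr_gt0.
rewrite !big_mkord sum_omega subKr.
set S := \sum_(i < I.+1) poisP _ _; set S1 := \sum_(i < I.+1) _ * poisP _ _.
set M := \sum_(i < I.+1) _ * omega _; set w := omega (Iplus I).
move=> [eqn CE].
have S0 : 0 < 1 - S by rewrite subr_gt0 sum_poisP_lt1.
have N0 : 0 < rho * beta - S1.
  rewrite /S1 sum_nat_poisP -[X in X - _]mulr1 -mulrBr mulr_gt0// subr_gt0.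
  exact: sum_poisP_lt1.
(* If [w] were 0, the right side of the twist equation would be 0, as a quotient by 0, while the
   left side is not. *)
have w0 : 0 < w.
  have := omega_simplex.1 (Iplus I); rewrite -/w le_eqVlt => /predU1P[w0|//].
  move: eqn; rewrite -w0 invr0 mulr0 => /eqP.
  by rewrite mulf_eq0 invr_eq0 !gt_eqF.
have C0 : 0 < C by rewrite CE divr_gt0.
(* The twist equations in product form: [CS] matches total mass and gives [F_0(0) = 1], [CN] matches
   the mean and gives [F_1(0) = 1]. *)
have CS : C * (1 - S) = w by rewrite CE divfK// gt_eqF.
have CN : C * (rho * beta - S1) = beta - M.
  by rewrite CE mulrAC -mulrA eqn mulrC divfK// gt_eqF.
have topC : opt_coef I.+1 = 0 by rewrite opt_coef_top (negbTE mean).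
have topE x : opt_system I.+1 x = C * rho ^+ I.+1 * expR (- (rho * x)).
  by rewrite /opt_system twisted_top topC !mul0r addr0.
have top0 x : 0 < opt_system I.+1 x.
  by rewrite topE !mulr_gt0 ?exprn_gt0 ?expR_gt0.
exists rho; split; first split.
- exact: ltW.
- by move=> x; rewrite topE /opt_system twisted_large// exprS; ring.
- rewrite /opt_system twisted00 sum_opt_coef topC -/S -/w -CS; ring.
- rewrite /opt_system twisted10 sum_nat_opt_coef topC -/S1 -/M mulr0 addr0.
  have -> : M = beta - C * (rho * beta - S1) by rewrite CN; ring.
  by field; rewrite gt_eqF.
split; first by right; split => //; rewrite gt_eqF.
by split; left.
Qed.

End twist.

Theorem theorem2p6 (R : realType) (I : nat) (beta : R) (omega : 'I_I.+2 -> R)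
    (rho C : R) :
  0 < beta -> simplex omega ->
  feasible (@empty_init R I) omega beta ->
  twist beta omega rho C ->
  A_set (@empty_init R I) omega beta (opt_path beta omega rho C) /\
  (forall g, A_set (@empty_init R I) omega beta g ->
     (J beta (opt_path beta omega rho C) <= J beta g)%E) /\
  EL beta omega C (opt_path beta omega rho C).
Proof.
move=> b0 ws _ tw; rewrite opt_pathE//.
(* The parameters enter only through [r] and the properties of the system listed here; the claims
   are then those of the abstract path. *)
have [r [[r0 Ftop F00 F10] [EL_case [rmean Fsign]]]] := twist_system b0 ws tw.
have dF := @opt_system_derive R I beta rho C omega b0.
have Fend := @opt_system_end R I beta rho C omega b0.
split; first exact: (system_path_A_set b0 ws r0 dF Ftop Fsign F00 F10 Fend).
split.
  by move=> g; exact: (system_path_minimal b0 ws r0 dF Ftop Fsign F00 F10 Fend rmean).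
rewrite /EL; case: EL_case => [[/eqP C0 rE]|[C0 F0]].
  rewrite C0; apply: (system_path_EL_reduced b0 ws r0 dF Ftop Fsign F00 F10 Fend rE).
  by case: ifP.
rewrite (negbTE C0).
exact: (system_path_EL_general b0 ws r0 dF Ftop Fsign F00 F10 Fend F0).
Qed.
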